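(* Let $\mathcal{A}$ be a complex unital $C^*$-algebra, let $\phi$ be a multiplicative Orlicz function and let $r,s\ge1$ be real. If $w,x,y,z\in\mathcal{A}$, then $$\phi\left(v^2\Big(\frac{x^*w+z^*y}{2}\Big)\right)\le\left\|\frac{(\phi(w^*w))^r+(\phi(y^*y))^r}{2}\right\|^{\frac1r}\left\|\frac{(\phi(x^*x))^s+(\phi(z^*z))^s}{2}\right\|^{\frac1s}.$$
   Context: $\mathbf 1$ is the unit of $\mathcal{A}$. $\mathcal{S}(\mathcal{A})=\{g\in\mathcal{A}^*: g(x^*x)\ge0\ \text{for all } x\in\mathcal{A},\ g(\mathbf 1)=1\}$ is the set of states and $v(x)=\sup\{|g(x)|: g\in\mathcal{S}(\mathcal{A})\}$ is the (algebraic) numerical radius; $v^2(x)$ means $(v(x))^2$. An Orlicz function is a map $\phi:[0,\infty)\to[0,\infty)$ that is continuous, convex, non-decreasing, with $\phi(0)=0$ and $\phi(u)\to\infty$ as $u\to\infty$; it is always assumed non-degenerate, i.e. $\phi(u)>0$ for $u>0$. It is multiplicative if $\phi(uv)=\phi(u)\phi(v)$ for all $u,v\ge0$. For a positive element $y$, $\phi(y)$ and real powers of $y$ are defined by continuous functional calculus. *)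

(* Defs.v *)
From HB Require Import structures.
From mathcomp Require Import all_boot all_order all_algebra.
From mathcomp Require Import complex.
From mathcomp Require Import all_classical all_reals all_analysis.
Set Implicit Arguments.
Unset Strict Implicit.
Unset Printing Implicit Defensive.
Import Order.TTheory GRing.Theory Num.Theory.
Import numFieldNormedType.Exports.
Local Open Scope classical_set_scope.
Local Open Scope ring_scope.
Local Open Scope complex_scope.

(* Norms of a [normedModType R[i]] live in [R[i]], where [0 <= z] means that
   z is a nonnegative real number.  The product is part of this mixin rather
   than inherited from [GRing.Algebra], because Hierarchy Builder cannot join
   [GRing.Algebra] with [CompleteNormedModule]: [Num.NumDomain] already
   inherits from both ring and seminormed structures.  The algebra structure
   is recovered by the instances that follow. *)
HB.mixin Record isCStarAlgebra (R : realType) A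
    of CompleteNormedModule R[i] A := {
  cstar_one : A;
  cstar_mul : A -> A -> A;
  cstar_mulA : associative cstar_mul;
  cstar_mul1l : left_id cstar_one cstar_mul;
  cstar_mul1r : right_id cstar_one cstar_mul;
  cstar_mulDl : left_distributive cstar_mul +%R;
  cstar_mulDr : right_distributive cstar_mul +%R;
  cstar_one_neq0 : cstar_one != 0;
  cstar_scaleAl : forall (k : R[i]) (x y : A),
    k *: cstar_mul x y = cstar_mul (k *: x) y;
  cstar_scaleAr : forall (k : R[i]) (x y : A),
    k *: cstar_mul x y = cstar_mul x (k *: y);
  cstar_normM : forall x y : A, `|cstar_mul x y| <= `|x| * `|y|;
  star : A -> A;
  starD : forall x y : A, star (x + y) = star x + star y;
  starZ : forall (k : R[i]) (x : A), star (k *: x) = conjc k *: star x;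
  starM : forall x y : A, star (cstar_mul x y) = cstar_mul (star y) (star x);
  starK : involutive star;
  cstar_norm_starM : forall x : A, `|cstar_mul (star x) x| = `|x| ^+ 2
}.

#[short(type="cstarAlgType")]
HB.structure Definition CStarAlgebra (R : realType) :=
  { A of isCStarAlgebra R A & CompleteNormedModule R[i] A }.

#[non_forgetful_inheritance]
HB.instance Definition _ (R : realType) (A : cstarAlgType R) :=
  GRing.Zmodule_isNzRing.Build (CStarAlgebra.sort A) (@cstar_mulA R A)
    (@cstar_mul1l R A) (@cstar_mul1r R A) (@cstar_mulDl R A)
    (@cstar_mulDr R A) (@cstar_one_neq0 R A).

#[non_forgetful_inheritance]
HB.instance Definition _ (R : realType) (A : cstarAlgType R) :=
  GRing.Lmodule_isLalgebra.Build R[i] (CStarAlgebra.sort A)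
    (@cstar_scaleAl R A).

#[non_forgetful_inheritance]
HB.instance Definition _ (R : realType) (A : cstarAlgType R) :=
  GRing.Lalgebra_isAlgebra.Build R[i] (CStarAlgebra.sort A)
    (@cstar_scaleAr R A).

Section CStar.
Variables (R : realType) (A : cstarAlgType R).
Implicit Types (a x : A).

Definition cnorm x : R := complex.Re `|x|.

Definition state (g : {linear A -> R[i]^o}) : Prop :=
  [/\ continuous g, forall x, 0 <= g (star x * x) & g 1 = 1].

Definition numerical_radius x : R :=
  sup [set complex.Re `|g x| | g in state].

Definition invertible x : Prop := exists y : A, x * y = 1 /\ y * x = 1.

Definition spectrum a : set R[i]^o := [set l | ~ invertible (a - l%:A)].

Definition continuous_on_spectrum a (f : R[i]^o -> R[i]^o) : Prop :=
  {within spectrum a, continuous f}.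

(* [Phi] is a unital *-homomorphism from C(spectrum a) to A that sends the
   inclusion of the spectrum into the complex numbers to [a].  Elements of
   C(spectrum a) are total functions continuous on the spectrum, identified
   when they agree there. *)
Definition functional_calculus a (Phi : (R[i] -> R[i]) -> A) : Prop :=
  let cont := continuous_on_spectrum a in
  [/\ forall f h, cont f -> cont h ->
        (forall l, spectrum a l -> f l = h l) -> Phi f = Phi h,
      [/\ forall f h, cont f -> cont h ->
            Phi (fun l => f l + h l) = Phi f + Phi h,
          forall (k : R[i]) f, cont f -> Phi (fun l => k * f l) = k *: Phi f,
          forall f h, cont f -> cont h ->
            Phi (fun l => f l * h l) = Phi f * Phi h
        & forall f, cont f -> Phi (fun l => conjc (f l)) = star (Phi f)],
      Phi (fun=> 1) = 1
    & Phi id = a].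

(* f(a); for normal [a] the map [Phi] exists and is unique on the functions
   continuous on the spectrum.  The value is 0 when f(a) is meaningless. *)
Definition cfc (f : R[i] -> R[i]) a : A :=
  xget 0 [set b | continuous_on_spectrum a f /\
                  exists2 Phi, functional_calculus a Phi & b = Phi f].

(* For positive [a], whose spectrum lies in [0, +oo[, only the values of [f]
   on [0, +oo[ matter. *)
Definition rcfc (f : R -> R) a : A := cfc (fun l => (f (complex.Re l))%:C) a.

End CStar.

(* Functions on [0, +oo[ are represented by total functions on R whose values
   at negative reals are unconstrained. *)
Definition orlicz (R : realType) (phi : R -> R) : Prop :=
  [/\ forall u, 0 <= u -> 0 <= phi u,
      {within `[0, +oo[, continuous phi},
      @convex_function R R^o `[0, +oo[ phi,
      {in `[0, +oo[ &, {homo phi : u v / u <= v}}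
    & [/\ phi 0 = 0,
          phi u @[u --> +oo] --> +oo
        & forall u, 0 < u -> 0 < phi u]].

Definition multiplicative_on_nonneg (R : realType) (phi : R -> R) : Prop :=
  forall u v, 0 <= u -> 0 <= v -> phi (u * v) = phi u * phi v.

(* Main.v *)
(* For a state g, the Cauchy-Schwarz inequality for the form of g on pairs gives
   |g((x*w + z*y)/2)|^2 <= g((w*w + y*y)/2) g((x*x + z*z)/2); then phi splits by
   multiplicativity, and convexity together with Jensen's inequality
   F(g(a)) <= g(F(a)) bounds each factor.  Jensen's inequality follows from a
   supporting line of F, because a function that is nonnegative on the spectrum is
   sent to a square of a self-adjoint element.

   The functional calculus of a self-adjoint a is obtained without Gelfand theory.
   If h, j are self-adjoint, commute and h^2 + j^2 = c, then h + ij is sqrt(c) times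
   a unitary, so |h| <= sqrt(c).  With square roots of 1 - b for |b| <= 1, this
   shows that |h|^2 - h^2 is never invertible, which by factoring polynomials gives
   |p(a)| <= sup |p| on the spectrum; the Weierstrass theorem does the rest. *)
Require Import Defs.
From mathcomp Require Import all_boot all_order all_algebra.
From mathcomp Require Import complex ring lra.
From mathcomp Require Import all_classical all_reals all_analysis.

Set Implicit Arguments.
Unset Strict Implicit.
Unset Printing Implicit Defensive.
Import Order.TTheory GRing.Theory Num.Theory.
Import numFieldNormedType.Exports.
Local Open Scope classical_set_scope.
Local Open Scope ring_scope.
Local Open Scope complex_scope.

(** The right-hand side makes sense only if [star w * w] has its spectrum in the nonnegative reals,
    a theorem usually derived from a functional calculus that is here still to be built. Square
    roots break the circle: an iteration yields roots that commute with everything commuting with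
    the given element, and positivity is then defined as being the square of a self-adjoint element.
    In this form states are visibly nonnegative on positive elements; an equivalent norm inequality
    gives closure under sums, and through it the positivity of [star w * w]. That [|h|^2 - h^2] is
    never invertible stands in for the spectral radius formula, and so for complex analysis. [rcfc]
    refers to some calculus picked by choice, so every fact about it has to come from the laws in
    [functional_calculus], not from the construction by polynomials. The numerical radius is a
    supremum, so the bound found for each state still has to be carried through [phi] by
    continuity. *)

Local Notation cabs k := (complex.Re `|k|).

(** * Norm, involution and convergence *)

Section NormStar.
Variables (R : realType) (A : cstarAlgType R).
Implicit Types (x y : A) (k : R[i]) (t : R).

Lemma RRe_ge0 k : 0 <= k -> (complex.Re k)%:C = k.
Proof. by move=> k0; rewrite RRe_real // ger0_real. Qed.

Lemma cnormE x : `|x| = (cnorm x)%:C.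
Proof. by rewrite /cnorm RRe_ge0. Qed.

Lemma cnorm_ge0 x : 0 <= cnorm x.
Proof. by rewrite -lecR -cnormE normr_ge0. Qed.

Lemma cnorm_eq0 x : cnorm x = 0 -> x = 0.
Proof. by move=> x0; apply/eqP; rewrite -normr_eq0 cnormE x0. Qed.

Lemma cnorm0 : cnorm (0 : A) = 0.
Proof. by rewrite /cnorm normr0. Qed.

Lemma cnormD x y : cnorm (x + y) <= cnorm x + cnorm y.
Proof. by rewrite -lecR rmorphD /= -!cnormE ler_normD. Qed.

Lemma cnormM x y : cnorm (x * y) <= cnorm x * cnorm y.
Proof. by rewrite -lecR rmorphM /= -!cnormE; exact: cstar_normM. Qed.

Lemma cnormZ k x : cnorm (k *: x) = cabs k * cnorm x.
Proof. by apply: complexI; rewrite /cnorm rmorphM /= !RRe_ge0 ?normrZ. Qed.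

Lemma Re_norm_real t : cabs t%:C = `|t|.
Proof. by rewrite normc_def /= expr0n addr0 sqrtr_sqr. Qed.

Lemma cnormZr t x : cnorm (t%:C *: x) = `|t| * cnorm x.
Proof. by rewrite cnormZ Re_norm_real. Qed.

Lemma cnormN x : cnorm (- x) = cnorm x.
Proof. by rewrite /cnorm normrN. Qed.

Lemma cnormB x y : cnorm (x - y) <= cnorm x + cnorm y.
Proof. by rewrite -[cnorm y]cnormN cnormD. Qed.

Lemma cnorm_distC x y : cnorm (x - y) = cnorm (y - x).
Proof. by rewrite -cnormN opprB. Qed.

Lemma cnorm_triangle y x z : cnorm (x - z) <= cnorm (x - y) + cnorm (y - z).
Proof. by rewrite -[x - z](subrKA y) cnormD. Qed.

Lemma starMr x y : star (x * y) = star y * star x.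
Proof. exact: starM. Qed.

Lemma cnorm_starM x : cnorm (star x * x) = cnorm x ^+ 2.
Proof. by apply: complexI; rewrite rmorphXn /= -!cnormE; exact: cstar_norm_starM. Qed.

Lemma cnorm_star x : cnorm (star x) = cnorm x.
Proof.
suff le y : cnorm y <= cnorm (star y).
  by apply/eqP; rewrite eq_le le -{2}[x]starK le.
have [y0|y0] := eqVneq (cnorm y) 0; first by rewrite y0 cnorm_ge0.
have y_gt0 : 0 < cnorm y by rewrite lt_neqAle eq_sym y0 cnorm_ge0.
by rewrite -(ler_pM2r y_gt0) -expr2 -cnorm_starM cnormM.
Qed.

Lemma star0 : star (0 : A) = 0.
Proof. by rewrite -(scale0r (0 : A)) starZ conjc0 !scale0r. Qed.

Lemma starN x : star (- x) = - star x.
Proof. by rewrite -scaleN1r starZ rmorphN1 scaleN1r. Qed.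

Lemma starB x y : star (x - y) = star x - star y.
Proof. by rewrite starD starN. Qed.

Lemma star1 : star (1 : A) = 1.
Proof. by rewrite -[LHS]mulr1 -[X in _ * X]starK -starMr mulr1 starK. Qed.

Lemma starZr t x : star (t%:C *: x) = t%:C *: star x.
Proof. by rewrite starZ conjc_real. Qed.

Lemma star_alg k : star (k%:A : A) = (conjc k)%:A.
Proof. by rewrite starZ star1. Qed.

Lemma cnorm1 : cnorm (1 : A) = 1.
Proof.
have := cnorm_starM 1; rewrite star1 mulr1 => /eqP.
rewrite -subr_eq0 expr2 -{1}[cnorm 1]mulr1 -mulrBr mulf_eq0 => /orP[/eqP/cnorm_eq0 /eqP|].
  by rewrite oner_eq0.
by rewrite subr_eq0 => /eqP.
Qed.

Lemma cnorm_alg k : cnorm (k%:A : A) = cabs k.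
Proof. by rewrite cnormZ cnorm1 mulr1. Qed.

Lemma cnorm_real_alg t : cnorm (t%:C%:A : A) = `|t|.
Proof. by rewrite cnorm_alg Re_norm_real. Qed.

(** Convergence with real epsilons: the norm of [A] takes its values in [R[i]], and [cnorm_complete]
    carries completeness over to this form. *)
Definition cvg_cnorm (y : nat -> A) (l : A) :=
  forall e, 0 < e -> exists n, forall m, (n <= m)%N -> cnorm (y m - l) <= e.

Lemma cnorm_complete (y : nat -> A) :
  (forall e, 0 < e -> exists n, forall m p, (n <= m)%N -> (n <= p)%N ->
     cnorm (y m - y p) <= e) -> exists l, cvg_cnorm y l.
Proof.
move=> yC.
have : cauchy (y n @[n --> \oo]).
  apply: cauchy_exP => e e0.
  have [re0 eE] : 0 < complex.Re e /\ e = (complex.Re e)%:C.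
    by rewrite -ltcR RRe_ge0 // ltW.
  have [n Hn] := yC (complex.Re e / 2) (divr_gt0 re0 (ltr0n _ 2)).
  exists (y n), n => // m /= nm; rewrite -ball_normE /= cnormE eE ltcR.
  apply: le_lt_trans (Hn _ _ (leqnn n) nm) _.
  by rewrite ltr_pdivrMr// ltr_pMr// ltr1n.
move=> /cauchy_cvgP cy; exists (lim (y n @[n --> \oo])) => e e0.
have e0' : (0 : R[i]) < e%:C by rewrite ltcR.
move/cvgrPdist_le : cy => /(_ _ e0') [n _ Hn].
exists n => m nm; have := Hn m nm.
by rewrite cnormE lecR cnorm_distC.
Qed.

End NormStar.

(** * Limits of sequences and the Neumann series *)

Section Complete.
Variables (R : realType) (A : cstarAlgType R).
Implicit Types (x y : A) (k : R[i]) (t : R).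

Lemma cvg_cnorm_unique (y : nat -> A) l l' :
  cvg_cnorm y l -> cvg_cnorm y l' -> l = l'.
Proof.
move=> yl yl'; apply/eqP; rewrite -subr_eq0; apply/eqP/cnorm_eq0/eqP.
rewrite eq_le cnorm_ge0 andbT; apply/ler_addgt0Pr => e e0; rewrite add0r.
have e20 : 0 < e / 2 by rewrite divr_gt0.
have [n Hn] := yl _ e20; have [m Hm] := yl' _ e20.
apply: le_trans (cnorm_triangle (y (maxn n m)) _ _) _.
rewrite [leRHS](splitr e) lerD ?Hm ?leq_maxr// cnorm_distC Hn ?leq_maxl//.
Qed.

Lemma cvg_cnorm_cst (l : A) : cvg_cnorm (fun=> l) l.
Proof. by move=> e e0; exists 0%N => m _; rewrite subrr cnorm0 ltW. Qed.

Lemma cvg_cnorm_shift (y : nat -> A) l :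
  cvg_cnorm y l -> cvg_cnorm (fun n => y n.+1) l.
Proof.
move=> yl e e0; have [n Hn] := yl e e0.
by exists n => m nm; rewrite Hn // leqW.
Qed.

Lemma cvg_cnormD (y z : nat -> A) l m :
  cvg_cnorm y l -> cvg_cnorm z m -> cvg_cnorm (fun n => y n + z n) (l + m).
Proof.
move=> yl zm e e0; have e20 : 0 < e / 2 by rewrite divr_gt0.
have [n Hn] := yl _ e20; have [p Hp] := zm _ e20.
exists (maxn n p) => q; rewrite geq_max => /andP[nq pq].
rewrite opprD addrACA (splitr e) (le_trans (cnormD _ _)) //.
by rewrite lerD ?Hn ?Hp.
Qed.

Lemma cvg_cnormM (y z : nat -> A) l m :
  cvg_cnorm y l -> cvg_cnorm z m -> cvg_cnorm (fun n => y n * z n) (l * m).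
Proof.
move=> yl zm e e0; pose C := cnorm l + cnorm m + 1.
have C0 : 0 < C by rewrite ltr_wpDl // addr_ge0 ?cnorm_ge0.
have d0 : 0 < e / (2 * C) by rewrite divr_gt0 // mulr_gt0.
have [n Hn] := yl _ d0; have [p Hp] := zm _ d0; have [q Hq] := zm _ ltr01.
exists (maxn n (maxn p q)) => i; rewrite !geq_max => /and3P[ni pi qi].
have -> : y i * z i - l * m = (y i - l) * z i + l * (z i - m).
  by rewrite mulrBl mulrBr addrA subrK.
have zC : cnorm (z i) <= C.
  rewrite -[z i](subrK m) (le_trans (cnormD _ _)) // /C.
  have := Hq i qi; have := cnorm_ge0 l; lra.
have lC : cnorm l <= C by rewrite /C -addrA lerDl addr_ge0 ?cnorm_ge0.
have -> : e = e / (2 * C) * C + C * (e / (2 * C)) by field; rewrite gt_eqF.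
rewrite (le_trans (cnormD _ _)) // lerD // (le_trans (cnormM _ _)) //.
  by rewrite ler_pM ?cnorm_ge0 ?Hn.
by rewrite ler_pM ?cnorm_ge0 ?Hp.
Qed.

Lemma cvg_cnormZ (y : nat -> A) l k :
  cvg_cnorm y l -> cvg_cnorm (fun n => k *: y n) (k *: l).
Proof.
move=> yl; rewrite -mulr_algl.
have -> : (fun n => k *: y n) = (fun n => k%:A * y n).
  by apply/funext => n; rewrite mulr_algl.
exact: cvg_cnormM (cvg_cnorm_cst _) yl.
Qed.

Lemma cvg_cnorm_star (y : nat -> A) l :
  cvg_cnorm y l -> cvg_cnorm (fun n => star (y n)) (star l).
Proof.
move=> yl e e0; have [n Hn] := yl e e0; exists n => m nm.
by rewrite -starB cnorm_star Hn.
Qed.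

Lemma cvg_cnorm_le (y : nat -> A) l (M : R) :
  cvg_cnorm y l -> (forall n, cnorm (y n) <= M) -> cnorm l <= M.
Proof.
move=> yl yM; apply/ler_addgt0Pr => e e0; have [n Hn] := yl e e0.
rewrite -[l](subKr (y n)) (le_trans (cnormB _ _)) // lerD //.
exact: Hn.
Qed.

(** Method of majorants: the increments of [s] bound norms, so [s] is nondecreasing, and beyond an
    index where it is within [e] of its supremum [y] moves by at most [e]. *)
Lemma cvg_cnorm_dominated (y : nat -> A) (s : nat -> R) (M : R) :
  (forall n, cnorm (y n.+1 - y n) <= s n.+1 - s n) -> (forall n, s n <= M) ->
  exists l, cvg_cnorm y l.
Proof.
move=> ys sM; apply: cnorm_complete => e e0.
have ys' n p : cnorm (y (p + n)%N - y n) <= s (p + n)%N - s n.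
  elim: p => [|p IH]; first by rewrite !add0n !subrr cnorm0.
  rewrite addSn (le_trans (cnorm_triangle (y (p + n)%N) _ _)) //.
  by rewrite (le_trans (lerD (ys _) IH)) // addrA subrK.
have s_sup : has_sup (range s).
  by split; [exists (s 0%N), 0%N | exists M => _ [n _ <-]].
have [_ [n _ <-] sn] := sup_adherent e0 s_sup.
have le m p : (n <= m)%N -> (m <= p)%N -> cnorm (y p - y m) <= e.
  move=> nm mp; rewrite -(subnK mp) (le_trans (ys' _ _)) //.
  have sp : s (p - m + m)%N <= sup (range s).
    by apply: ub_le_sup; [exact: s_sup.2 | exists (p - m + m)%N].
  have smn : s n <= s m.
    by rewrite -subr_ge0 -(subnK nm) (le_trans (cnorm_ge0 _) (ys' n (m - n)%N)).
  lra.
exists n => m p nm np; case/orP: (leq_total m p) => [mp|pm].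
  by rewrite cnorm_distC le.
exact: le.
Qed.

Lemma invertible1 : invertible (1 : A).
Proof. by exists 1; rewrite mulr1. Qed.

Lemma invertibleM x y : invertible x -> invertible y -> invertible (x * y).
Proof.
move=> [u [xu ux]] [v [yv vy]]; exists (v * u); split.
  by rewrite mulrA -(mulrA x) yv mulr1 xu.
by rewrite mulrA -(mulrA v) ux mulr1 vy.
Qed.

Lemma invertibleZ k x : k != 0 -> invertible x -> invertible (k *: x).
Proof.
move=> k0 [u [xu ux]]; exists (k^-1 *: u).
by rewrite -!scalerAr -!scalerAl !scalerA xu ux mulVf // mulfV // !scale1r.
Qed.

Lemma invertibleN x : invertible x -> invertible (- x).
Proof. by rewrite -scaleN1r; apply: invertibleZ; rewrite oppr_eq0 oner_eq0. Qed.

(** The iterates [y n] are the partial sums of the geometric series and [s n] those of its majorant,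
    bounded by [(1 - q)^-1]. The limit solves [l = 1 + x l] and commutes with [x], so it is a
    two-sided inverse. *)
Lemma neumann x : cnorm x < 1 -> invertible (1 - x).
Proof.
set q := cnorm x => q1; have q0 : 0 <= q := cnorm_ge0 x.
pose y n := iter n (fun y => 1 + x * y) 0.
pose s n := iter n (fun s => 1 + q * s) 0.
have ys n : cnorm (y n.+1 - y n) <= s n.+1 - s n.
  elim: n => [|n IH]; first by rewrite /y /s /= !mulr0 !addr0 !subr0 cnorm1.
  rewrite /y /s !iterS -/(y n) -/(s n) -/(y n.+1) -/(s n.+1).
  rewrite [1 + x * _]addrC [1 + q * s n.+1]addrC !addrKA -!mulrBr.
  by rewrite (le_trans (cnormM _ _)) // ler_wpM2l.
have sM n : s n <= (1 - q)^-1.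
  elim: n => [|n IH]; first by rewrite /s /= invr_ge0 subr_ge0 ltW.
  rewrite /s iterS -/(s n) (le_trans (lerD (lexx 1) (ler_wpM2l q0 IH))) //.
  by rewrite le_eqVlt; apply/orP; left; apply/eqP; field; rewrite gt_eqF // subr_gt0.
have [l yl] := cvg_cnorm_dominated ys sM.
have comm n : y n * x = x * y n.
  elim: n => [|n IH]; first by rewrite /y /= mulr0 mul0r.
  by rewrite /y iterS -/(y n) mulrDl mulrDr mul1r mulr1 -mulrA IH.
have lx : l * x = x * l.
  apply: (@cvg_cnorm_unique (fun n => y n * x)).
    exact: cvg_cnormM yl (cvg_cnorm_cst x).
  have -> : (fun n => y n * x) = (fun n => x * y n) by apply/funext.
  exact: cvg_cnormM (cvg_cnorm_cst x) yl.
have lE : l = 1 + x * l.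
  apply: (cvg_cnorm_unique (cvg_cnorm_shift yl)).
  exact: cvg_cnormD (cvg_cnorm_cst 1) (cvg_cnormM (cvg_cnorm_cst x) yl).
by exists l; rewrite mulrBl mulrBr lx mul1r mulr1 {1 3}lE addrK.
Qed.

Lemma invertible_sub_alg x k : cnorm x < cabs k -> invertible (x - k%:A).
Proof.
move=> xk; have k0 : k != 0.
  by apply: contraTneq xk => ->; rewrite normr0 -leNgt cnorm_ge0.
have -> : x - k%:A = (- k) *: (1 - k^-1 *: x).
  by rewrite scalerBr scalerA mulNr mulfV // scaleN1r scaleNr opprK addrC.
apply: invertibleZ; first by rewrite oppr_eq0.
apply: neumann; rewrite cnormZ.
have k1 : 0 < cabs k by apply: le_lt_trans xk; exact: cnorm_ge0.
suff -> : cabs (k^-1) = (cabs k)^-1 by rewrite mulrC ltr_pdivrMr // mul1r.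
apply: complexI; rewrite RRe_ge0 // normfV.
by rewrite -[in LHS](RRe_ge0 (normr_ge0 k)) -fmorphV.
Qed.

End Complete.

(** * Squares of self-adjoint elements *)

Section Squares.
Variables (R : realType) (A : cstarAlgType R).
Implicit Types (a b c h u x y : A) (k : R[i]) (t : R).

Lemma comm_scale k x y : GRing.comm x y -> GRing.comm x (k *: y).
Proof. by rewrite /GRing.comm => xy; rewrite -scalerAr -scalerAl xy. Qed.

(* [1 - h] is the limit of the iteration [y |-> (b + y^2) / 2] from [0], whose
   increments are dominated by those of the same iteration at the number 1. *)
Lemma sqrt_one_sub b : star b = b -> cnorm b <= 1 ->
  exists h, [/\ star h = h, h * h = 1 - b, cnorm (1 - h) <= 1 &
                forall c, GRing.comm c b -> GRing.comm c h].
Proof.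
move=> bsa b1; pose q : R[i] := (2^-1)%:C.
have qq : q + q = 1 by rewrite -rmorphD /= -div1r -splitr.
pose y n := iter n (fun y => q *: (b + y * y)) 0.
pose s n := iter n (fun s : R => (1 + s ^+ 2) / 2) 0.
have yS n : y n.+1 = q *: (b + y n * y n) by [].
have sS n : s n.+1 = (1 + s n ^+ 2) / 2 by [].
have s01 n : 0 <= s n <= 1.
  elim: n => [|n /andP[s0 s1]]; first by rewrite /s /= lexx ler01.
  have : 0 <= s n ^+ 2 <= 1 by rewrite sqr_ge0 /= expr_le1.
  rewrite sS; lra.
have ysa n : star (y n) = y n.
  elim: n => [|n IH]; first exact: star0.
  by rewrite yS starZr starD bsa starMr IH.
have ycomm n c : GRing.comm c b -> GRing.comm c (y n).
  move=> cb; elim: n => [|n IH]; first exact: commr0.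
  by rewrite yS; apply: comm_scale; apply: commrD => //; apply: commrM.
have yn n : cnorm (y n) <= s n.
  elim: n => [|n IH]; first by rewrite cnorm0.
  rewrite yS sS cnormZr ger0_norm ?invr_ge0 // mulrC ler_pM2r ?invr_gt0 //.
  rewrite (le_trans (cnormD _ _)) // lerD // (le_trans (cnormM _ _)) //.
  by rewrite expr2 ler_pM ?cnorm_ge0.
have yD n : cnorm (y n.+1 - y n) <= s n.+1 - s n.
  elim: n => [|n IH].
    rewrite yS sS /= mulr0 addr0 expr0n addr0 !subr0 cnormZr.
    by rewrite ger0_norm ?invr_ge0 // mulrC ler_pM2r ?invr_gt0.
  rewrite (yS n.+1) {2}(yS n) (sS n.+1) {2}(sS n) -scalerBr opprD addrACA subrr add0r.
  (* This splitting is valid without commutation, and the difference of the scalar squares splits in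
     the same way. *)
  have -> : y n.+1 * y n.+1 - y n * y n =
      y n.+1 * (y n.+1 - y n) + (y n.+1 - y n) * y n.
    by rewrite mulrBr mulrBl addrA subrK.
  rewrite cnormZr ger0_norm ?invr_ge0 //.
  have := yn n; have := yn n.+1; have := cnorm_ge0 (y n.+1 - y n).
  move: IH; set d := y n.+1 - y n => IH d0 y1 y0.
  have := cnormD (y n.+1 * d) (d * y n).
  have := cnormM (y n.+1) d; have := cnormM d (y n).
  have := cnorm_ge0 (y n.+1); have := cnorm_ge0 (y n).
  have : cnorm (y n.+1) * cnorm d <= s n.+1 * (s n.+1 - s n).
    by rewrite ler_pM ?cnorm_ge0.
  have : cnorm d * cnorm (y n) <= (s n.+1 - s n) * s n.
    by rewrite ler_pM ?cnorm_ge0.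
  nra.
have [l yl] := cvg_cnorm_dominated yD (fun n => proj2 (andP (s01 n))).
have lE : l = q *: (b + l * l).
  apply: (cvg_cnorm_unique (cvg_cnorm_shift yl)).
  by apply: cvg_cnormZ; apply: cvg_cnormD (cvg_cnorm_cst b) (cvg_cnormM yl yl).
exists (1 - l); split.
- rewrite starB star1; congr (_ - _).
  apply: (cvg_cnorm_unique (cvg_cnorm_star yl)).
  by have -> : (fun n => star (y n)) = y by apply/funext.
- have : l + l = b + l * l by rewrite [in LHS]lE -scalerDl qq scale1r.
  move=> ll; have -> : b = l + l - l * l by rewrite ll addrK.
  by rewrite mulrBl mul1r mulrBr mulr1 -addrA -opprD addrA.
- rewrite subKr; apply: cvg_cnorm_le yl _ => n.
  by rewrite (le_trans (yn n)) //; case/andP: (s01 n).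
- move=> c cb; apply: commrB; first exact: commr1.
  apply: (@cvg_cnorm_unique _ _ (fun n => c * y n)).
    exact: cvg_cnormM (cvg_cnorm_cst c) yl.
  have -> : (fun n => c * y n) = (fun n => y n * c).
    by apply/funext => n; exact: ycomm.
  exact: cvg_cnormM yl (cvg_cnorm_cst c).
Qed.

(* [h + i j] is a multiple of a unitary, and [h] is its real part. *)
Lemma cnorm_le_sqrt_sum_squares h j t : 0 <= t -> star h = h -> star j = j ->
  GRing.comm h j -> h * h + j * j = t%:C%:A -> cnorm h <= Num.sqrt t.
Proof.
move=> t0 hsa jsa hj hhjj; pose u := h + 'i%C *: j.
have us : star u = h - 'i%C *: j.
  rewrite starD starZ hsa jsa -scaleNr; congr (_ + _ *: _).
  by apply/eqP; rewrite eq_complex /= oppr0 !eqxx.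
have uu : star u * u = t%:C%:A.
  rewrite us mulrDr !mulrBl -!scalerAr -!scalerAl scalerA.
  rewrite -[in 'i%C * _]expr2 sqr_i scaleN1r opprK hj -hhjj.
  by rewrite addrACA [X in _ + _ + X]addrC addrACA !addrA; rewrite addrAC subrK // addrC.
have nu : cnorm u = Num.sqrt t.
  apply/eqP; rewrite -(eqrXn2 (ltn0Sn 1)) ?cnorm_ge0 ?sqrtr_ge0 //.
  by rewrite sqr_sqrtr // -cnorm_starM uu cnorm_real_alg ger0_norm.
have hu : h = (2^-1)%:C *: (u + star u).
  rewrite us addrACA subrr addr0 scalerDr -scalerDl -rmorphD /=.
  by rewrite -[2^-1]div1r -splitr scale1r.
rewrite hu cnormZr ger0_norm ?invr_ge0 //.
have := cnormD u (star u); rewrite cnorm_star nu; lra.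
Qed.

(** Let [j] be a square root of [1 - h^2] commuting with [h]. As [j^2 + h^2 = 1], the norm of [j] is
    at most 1, and so is that of [j^2]. *)
Lemma cnorm_one_sub_square h : star h = h -> cnorm h <= 1 -> cnorm (1 - h * h) <= 1.
Proof.
move=> hsa h1.
have hhsa : star (h * h) = h * h by rewrite starMr hsa.
have hh1 : cnorm (h * h) <= 1.
  by rewrite (le_trans (cnormM _ _)) // mulr_ile1 ?cnorm_ge0.
have [j [jsa jj _ jc]] := sqrt_one_sub hhsa hh1.
rewrite -jj (le_trans (cnormM _ _)) //.
suff : cnorm j <= 1 by move=> j1; rewrite mulr_ile1 ?cnorm_ge0.
rewrite -sqrtr1; apply: (@cnorm_le_sqrt_sum_squares j h 1) => //.
  by apply: commr_sym; apply: jc; apply: commrM.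
by rewrite jj subrK scale1r.
Qed.

(* Arens' trick: shifting [a] by [i t] moves a nonreal [k] outside the disc of
   radius [|a + i t|] for a suitable real [t]. *)
Lemma invertible_sub_nonreal a k : star a = a -> complex.Im k != 0 ->
  invertible (a - k%:A).
Proof.
move=> asa; case: k => al be /= be0.
have [a' a'sa ->] : exists2 a', star a' = a' & a = a' + al%:C%:A.
  by exists (a - al%:C%:A); rewrite ?subrK // starB asa starZr star1.
(* [|a' + it|^2] is at most [|a'|^2 + t^2]. With [be * t = |a'|^2], the square [(be + t)^2] exceeds
   this bound by [be^2 + |a'|^2]. *)
pose t := cnorm a' ^+ 2 / be; pose it : R[i] := Complex 0 t.
have -> : a' + al%:C%:A - (al +i* be)%:A = (a' + it%:A) - (Complex 0 (be + t))%:A.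
  rewrite -!scaleNr -!addrA -!scalerDl; congr (_ + _ *: _).
  by apply/eqP; rewrite eq_complex /=; apply/andP; split; apply/eqP; ring.
apply: invertible_sub_alg.
rewrite normc_def /= expr0n add0r sqrtr_sqr -(ltr_pXn2r (ltn0Sn 1)) ?nnegrE ?cnorm_ge0 //.
have -> : cnorm (a' + it%:A) ^+ 2 = cnorm (a' * a' + (t ^+ 2)%:C%:A).
  rewrite -cnorm_starM starD a'sa star_alg; congr cnorm.
  rewrite mulrDr !mulrDl mulr_algr !mulr_algl scalerA.
  rewrite -!addrA; congr (_ + _); rewrite addrA -scalerDl.
  have -> : conjc it + it = 0 by apply/eqP; rewrite eq_complex /= addr0 addNr eqxx.
  rewrite scale0r add0r; congr (_ *: _).
  by apply/eqP; rewrite eq_complex /=; apply/andP; split; apply/eqP; ring.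
rewrite real_normK ?num_real //.
apply: le_lt_trans (cnormD _ _) _; rewrite cnorm_real_alg.
have := cnormM a' a'; rewrite -expr2 [`|t ^+ 2|]ger0_norm ?sqr_ge0 //.
have bt : be * t = cnorm a' ^+ 2 by rewrite /t mulrCA mulfV // mulr1.
have : 0 < be ^+ 2 by rewrite lt_neqAle sqr_ge0 eq_sym sqrf_eq0 be0.
have := sqr_ge0 (cnorm a'); rewrite sqrrD bt; lra.
Qed.

End Squares.

(** * Positive elements and their spectrum *)

Section Positivity.
Variables (R : realType) (A : cstarAlgType R).
Implicit Types (a b c e h j l n u v x y : A) (k : R[i]) (t T : R).

Lemma inverse_comm x y c : x * y = 1 -> y * x = 1 -> GRing.comm c x -> GRing.comm c y.
Proof.
by move=> xy yx cx; rewrite /GRing.comm -[c * y]mul1r -yx -mulrA (mulrA x) -cx -mulrA xy mulr1.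
Qed.

Lemma inverse_selfadjoint x y : x * y = 1 -> y * x = 1 -> star x = x -> star y = y.
Proof.
move=> xy yx xsa; have sx : star y * x = 1 by rewrite -[X in _ * X]xsa -starMr xy star1.
by rewrite -[LHS]mulr1 -xy mulrA sx mul1r.
Qed.

(* If [e] inverted [1 - h^2], then [h^2 + j^2 = 1 - eps] for the product [j] of
   the commuting square roots of [1 - h^2] and [1 - eps e], so that [|h| < 1]. *)
Lemma norm1_not_invertible h : star h = h -> cnorm h = 1 -> ~ invertible (1 - h * h).
Proof.
move=> hsa h1 [e [he eh]].
have hhsa : star (h * h) = h * h by rewrite starMr hsa.
have esa : star e = e by apply: inverse_selfadjoint he eh _; rewrite starB star1 hhsa.
have ch c : GRing.comm c (h * h) -> GRing.comm c e.
  by move=> ?; apply: inverse_comm he eh _; apply: commrB => //; exact: commr1.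
have hh1 : cnorm (h * h) <= 1 by rewrite (le_trans (cnormM _ _)) // h1 mulr1.
have hhh : GRing.comm h (h * h) by apply: commrM.
(* Small enough for [1 - eps e] to have a square root; the summand 1 also keeps [1 - eps]
   nonnegative. *)
pose eps := (1 + cnorm e)^-1.
have e0 : 0 < 1 + cnorm e by rewrite ltr_wpDr // cnorm_ge0.
have eps0 : 0 < eps by rewrite invr_gt0.
have eps1 : eps <= 1 by rewrite invf_le1 // lerDl cnorm_ge0.
have epse : cnorm (eps%:C *: e) <= 1.
  by rewrite cnormZr gtr0_norm // mulrC ler_pdivrMr // mul1r lerDr.
have [k [ksa kk _ kc]] := sqrt_one_sub hhsa hh1.
have [m [msa mm _ mc]] := sqrt_one_sub (etrans (starZr _ _) (congr1 _ esa)) epse.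
have mcomm c : GRing.comm c (h * h) -> GRing.comm c m.
  by move=> ?; apply: mc; apply: comm_scale; exact: ch.
have km : GRing.comm k m.
  by apply: mcomm; apply: commr_sym; exact: kc.
have : cnorm h <= Num.sqrt (1 - eps).
  apply: (@cnorm_le_sqrt_sum_squares _ _ h (k * m)) => //.
  - by rewrite subr_ge0.
  - by rewrite starMr ksa msa km.
  - by apply: commrM; [exact: kc | exact: mcomm].
  - rewrite mulrA -[k * m * k]mulrA -km mulrA kk -mulrA mm mulrBr mulr1.
    rewrite -scalerAr he addrA addrCA subrr addr0.
    by rewrite rmorphB /= scalerBl scale1r.
rewrite h1 leNgt => /negP; apply.
by rewrite -[ltRHS]sqrtr1 ltr_sqrt ?ltr01 // ltrBlDr ltrDl.
Qed.

(** Rescaling to norm one. This puts [|h|^2] in the spectrum of [h^2], which is the substitute for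
    the spectral radius formula. *)
Lemma norm_square_not_invertible h :
  star h = h -> ~ invertible ((cnorm h ^+ 2)%:C%:A - h * h).
Proof.
move=> hsa; have [m0|m0] := eqVneq (cnorm h) 0.
  rewrite m0 expr0n scale0r (cnorm_eq0 m0) mulr0 subr0 => -[y [+ _]].
  by rewrite mul0r => /esym/eqP; rewrite oner_eq0.
set m := cnorm h in m0 *; move=> inv.
have hm0 : 0 < m by rewrite lt_neqAle eq_sym m0 cnorm_ge0.
pose h' := m^-1%:C *: h.
apply: (@norm1_not_invertible h').
- by rewrite starZr hsa.
- by rewrite cnormZr gtr0_norm ?invr_gt0 // mulVf.
have -> : 1 - h' * h' = (m ^- 2)%:C *: ((m ^+ 2)%:C%:A - h * h).
  rewrite scalerBr scalerA -rmorphM /= mulVf ?expf_neq0 // scale1r.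
  by rewrite -scalerAr -scalerAl scalerA -rmorphM /= -expr2 exprVn.
apply: invertibleZ inv; apply/eqP => /(congr1 (@complex.Re _)) /= /eqP.
by rewrite invr_eq0 expf_eq0 (negbTE m0).
Qed.

(* Positivity; its equivalence with the usual notions is [cpos_spectrum],
   [cpos_cnorm] with [cnorm_cpos], and [cpos_starM]. *)
Definition cpos h := exists2 j, star j = j & h = j * j.

(** For [T > 0], dividing [j] by the square root of [T] reduces this to [cnorm_one_sub_square]. With
    the converse [cnorm_cpos] it describes positivity by a norm inequality, which adds up under
    sums. *)
Lemma cpos_cnorm h T : cpos h -> cnorm h <= T -> cnorm (T%:C%:A - h) <= T.
Proof.
move=> [j jsa ->] hT.
have jT : cnorm j ^+ 2 <= T by rewrite -cnorm_starM jsa.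
have [T0|T0] := eqVneq T 0.
  have -> : j = 0.
    by move: jT; rewrite T0 => jT; apply/cnorm_eq0/eqP; rewrite -sqrf_eq0 eq_le jT sqr_ge0.
  by rewrite T0 scale0r mulr0 subrr cnorm0.
have Tgt0 : 0 < T by rewrite lt_neqAle eq_sym T0 (le_trans (sqr_ge0 _) jT).
have sT0 : 0 < Num.sqrt T by rewrite sqrtr_gt0.
have sT : Num.sqrt T ^+ 2 = T by rewrite sqr_sqrtr // ltW.
pose j' := (Num.sqrt T)^-1%:C *: j.
have -> : T%:C%:A - j * j = T%:C *: (1 - j' * j').
  have -> : j' * j' = T^-1%:C *: (j * j).
    by rewrite -scalerAr -scalerAl scalerA -rmorphM /= -expr2 exprVn sT.
  by rewrite scalerBr scalerA -rmorphM /= mulfV // scale1r.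
rewrite cnormZr gtr0_norm //; apply: ler_piMr; first exact: ltW.
apply: cnorm_one_sub_square; first by rewrite starZr jsa.
rewrite cnormZr gtr0_norm ?invr_gt0 // mulrC ler_pdivrMr // mul1r.
by rewrite -(ler_pXn2r (ltn0Sn 1)) ?nnegrE ?cnorm_ge0 ?sqrtr_ge0 // sT.
Qed.

Lemma cnorm_cpos h T : star h = h -> 0 < T -> cnorm (T%:C%:A - h) <= T -> cpos h.
Proof.
move=> hsa T0 hT.
have sT : Num.sqrt T ^+ 2 = T by rewrite sqr_sqrtr // ltW.
pose b := T^-1%:C *: (T%:C%:A - h).
have bsa : star b = b by rewrite starZr starB starZr star1 hsa.
have b1 : cnorm b <= 1.
  by rewrite cnormZr gtr0_norm ?invr_gt0 // mulrC ler_pdivrMr // mul1r.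
have [j [jsa jj _ _]] := sqrt_one_sub bsa b1.
exists ((Num.sqrt T)%:C *: j); first by rewrite starZr jsa.
rewrite -scalerAr -scalerAl scalerA -rmorphM /= -expr2 sT jj.
rewrite scalerBr /b scalerA -rmorphM /= mulfV ?gt_eqF // scale1r.
by rewrite subKr.
Qed.

Lemma cpos_selfadjoint h : cpos h -> star h = h.
Proof. by move=> [j jsa ->]; rewrite starMr jsa. Qed.

Lemma cposD h h' : cpos h -> cpos h' -> cpos (h + h').
Proof.
(* The [+ 1] makes the radius positive, as [cnorm_cpos] requires, also for [h = h' = 0]. *)
move=> hp h'p; pose T := cnorm h + 1; pose T' := cnorm h' + 1.
apply: (@cnorm_cpos _ (T + T')).
- by rewrite starD !cpos_selfadjoint.
- by apply: addr_gt0; apply: ltr_wpDl; rewrite ?cnorm_ge0.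
rewrite rmorphD /= scalerDl opprD addrACA (le_trans (cnormD _ _)) //.
by rewrite lerD // cpos_cnorm // lerDl.
Qed.

(** [j^2 - k] factors through the complex square roots of [k], which are nonreal unless [0 <= k];
    both factors are then invertible because [j] is self-adjoint. *)
Lemma cpos_spectrum h k : cpos h -> spectrum h k -> 0 <= k.
Proof.
move=> [j jsa ->]; apply: contra_notT => k0.
have sk : sqrtc k * sqrtc k = k by rewrite -expr2 sqr_sqrtc.
have Im0 : complex.Im (sqrtc k) != 0.
  apply: contraNneq k0 => Im0.
  rewrite -sk; case: (sqrtc k) Im0 => re im /= ->.
  by rewrite lecE /= !mulr0 !mul0r addr0 eqxx subr0 -expr2 sqr_ge0.
have -> : j * j - k%:A = (j - (sqrtc k)%:A) * (j - (- sqrtc k)%:A).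
  rewrite scaleNr opprK mulrDr !mulrBl mulr_algr !mulr_algl scalerA sk.
  by rewrite addrA subrK.
apply: invertibleM; apply: invertible_sub_nonreal => //.
by rewrite raddfN /= oppr_eq0.
Qed.

Lemma cpos_shift_invertible h t : cpos h -> 0 < t -> invertible (h + t%:C%:A).
Proof.
move=> hp t0; apply: contrapT => inv.
have : 0 <= (- t)%:C.
  by apply: (@cpos_spectrum h) => //; rewrite /spectrum /= rmorphN scaleNr opprK.
by rewrite ler0c oppr_ge0 leNgt t0.
Qed.

(** If [e] inverts [x y + k], then [(1 - y e x) / k] inverts [y x + k]: Jacobson's identity for the
    common nonzero spectrum of [x y] and [y x]. *)
Lemma invertible_swap x y k : k != 0 ->
  invertible (x * y + k%:A) -> invertible (y * x + k%:A).
Proof.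
move=> k0 [e [he eh]]; exists (k^-1 *: (1 - y * e * x)).
have yE : (y * x + k%:A) * y = y * (x * y + k%:A).
  by rewrite mulrDl mulrDr mulr_algl mulr_algr mulrA.
have xE : x * (y * x + k%:A) = (x * y + k%:A) * x.
  by rewrite mulrDl mulrDr mulr_algl mulr_algr mulrA.
rewrite -scalerAr -scalerAl mulrBr mulrBl mulr1 mul1r.
have -> : (y * x + k%:A) * (y * e * x) = y * x.
  by rewrite !mulrA yE -(mulrA y) he mulr1.
have -> : y * e * x * (y * x + k%:A) = y * x.
  by rewrite -(mulrA (y * e)) xE mulrA -(mulrA y) eh mulr1.
by rewrite addrAC subrr add0r scalerA mulVf // scale1r.
Qed.

(** [l * l] plays the role of [|a|]. After scaling to norm one, [p] is the root of
    [a'^2 = 1 - (1 - a'^2)], and the bound on [1 - p] that comes with it allows a second root. *)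
Lemma quartic_root a : star a = a ->
  exists l, [/\ star l = l, GRing.comm l a & (l * l) * (l * l) = a * a].
Proof.
move=> asa; have [a0|a0] := eqVneq (cnorm a) 0.
  by exists 0; rewrite (cnorm_eq0 a0) star0 !mulr0; split => //; exact: commr0.
set m := cnorm a in a0.
have m0 : 0 < m by rewrite lt_neqAle eq_sym a0 cnorm_ge0.
pose a' := m^-1%:C *: a.
have a'sa : star a' = a' by rewrite starZr asa.
have a'1 : cnorm a' <= 1 by rewrite cnormZr gtr0_norm ?invr_gt0 // mulVf.
have bsa : star (1 - a' * a') = 1 - a' * a' by rewrite starB star1 starMr a'sa.
have [p [psa pp p1 pc]] := sqrt_one_sub bsa (cnorm_one_sub_square a'sa a'1).
have p'sa : star (1 - p) = 1 - p by rewrite starB star1 psa.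
have [l [lsa ll _ lc]] := sqrt_one_sub p'sa p1.
have sm : Num.sqrt m ^+ 2 = m by rewrite sqr_sqrtr // ltW.
have aa' : GRing.comm a a' by apply: comm_scale.
exists ((Num.sqrt m)%:C *: l); split; first by rewrite starZr lsa.
  apply: commr_sym; apply: comm_scale; apply: lc.
  apply: commrB; [exact: commr1|apply: pc].
  by apply: commrB; [exact: commr1|exact: commrM].
have -> : (Num.sqrt m)%:C *: l * ((Num.sqrt m)%:C *: l) = m%:C *: p.
  by rewrite -scalerAr -scalerAl scalerA -rmorphM /= -expr2 sm ll subKr.
have aE : a = m%:C *: a' by rewrite scalerA -rmorphM /= mulfV // scale1r.
have -> : a * a = (m%:C *: a') * (m%:C *: a') by rewrite -aE.
by clearbody a'; rewrite -!scalerAr -!scalerAl pp subKr.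
Qed.

(* With [q = |a|] for [a = u* u], the element [v = u (q - a)] satisfies
   [v* v = - n^2] for a self-adjoint [n]; as [v v* + v* v] is a sum of squares
   and [v v*], [v* v] have the same nonzero spectrum, [n = 0] and [q = a]. *)
Lemma cpos_starM u : cpos (star u * u).
Proof.
pose a := star u * u; have asa : star a = a by rewrite starMr starK.
have [l [lsa la ll]] := quartic_root asa.
pose q := l * l; have qa : GRing.comm q a by apply: commr_sym; apply: commrM; exact: commr_sym.
have qsa : star q = q by rewrite starMr lsa.
pose d := q - a; have dsa : star d = d by rewrite starB qsa asa.
have ld : GRing.comm l d by apply: commrB => //; apply: commrM.
pose n := l * d; have nsa : star n = n by rewrite starMr lsa dsa -ld.
pose v := u * d.
(* [q^2 = a^2] makes [(q + a) (q - a)] vanish: [d] is twice the negative part of [a]. *)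
have ad : a * d = - (q * d).
  by rewrite /d !mulrBr -/q -[a * a]ll opprB qa.
have vv : star v * v = - (n * n).
  rewrite starMr dsa -mulrA (mulrA (star u)) -/a ad mulrN; congr (- _).
  by rewrite /n ld -mulrA; congr (d * _); rewrite -ld mulrA.
(* Up to sign, twice the real and imaginary parts of [v]; the sum of their squares is
   [2 (v (star v) + (star v) v)]. *)
pose w := v + star v; pose w' := 'i%C *: (v - star v).
have wsa : star w = w by rewrite starD starK addrC.
have w'sa : star w' = w'.
  rewrite starZ starB starK -opprB scalerN -scaleNr; congr (_ *: _).
  by apply/eqP; rewrite eq_complex /= oppr0 opprK !eqxx.
have vvs : 2%:C *: (v * star v) = w * w + w' * w' + (n * n + n * n).
  have -> : w * w + w' * w' = v * star v + star v * v + (v * star v + star v * v).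
    rewrite -scalerAr -scalerAl scalerA -[in X in X *: _]expr2 sqr_i scaleN1r.
    have sq x y : (x + y) * (x + y) = x * x + y * y + (x * y + y * x).
      by rewrite mulrDl !mulrDr [y * x + _]addrC addrACA.
    by rewrite !sq !mulrN !mulNr opprK -opprD opprB addrC addrA subrK.
  rewrite vv addrACA !subrK rmorphD /= scalerDl scale1r //.
have vvs_pos : cpos (2%:C *: (v * star v)).
  by rewrite vvs; apply: cposD; apply: cposD; [exists w|exists w'|exists n|exists n].
(* Otherwise [|n|^2 - n^2 = |n|^2 + (star v) v] would be invertible, since [|n|^2 + v (star v)] is,
   against [norm_square_not_invertible]. *)
have n0 : n = 0.
  apply/cnorm_eq0/eqP; apply: contrapT => /negP n0.
  have n20 : 0 < cnorm n ^+ 2 by rewrite exprn_even_gt0.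
  apply: (@norm_square_not_invertible n nsa).
  rewrite addrC -vv; apply: invertible_swap.
    by apply/eqP => /(congr1 (@complex.Re _)) /= /eqP; rewrite gt_eqF.
  have -> : v * star v + (cnorm n ^+ 2)%:C%:A =
      (2^-1)%:C *: (2%:C *: (v * star v) + (2 * cnorm n ^+ 2)%:C%:A).
    by rewrite scalerDr !scalerA -!rmorphM /= mulrA mulVf // mul1r scale1r.
  apply: invertibleZ.
    by apply/eqP => /(congr1 (@complex.Re _)) /= /eqP; rewrite invr_eq0 pnatr_eq0.
  by apply: cpos_shift_invertible => //; rewrite mulr_gt0.
have qd : q * d = 0 by rewrite /q -mulrA -/n n0 mulr0.
have ad0 : a * d = 0 by rewrite ad qd oppr0.
have d0 : d = 0.
  apply/cnorm_eq0/eqP; rewrite -sqrf_eq0 -cnorm_starM dsa.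
  by rewrite {1}/d mulrBl qd ad0 subr0 cnorm0.
by exists l => //; apply/esym/eqP; rewrite -subr_eq0; apply/eqP.
Qed.

End Positivity.

(** * Functional calculus of a self-adjoint element *)

Section Polynomials.
Variables (R : realType) (A : cstarAlgType R).
Implicit Types (a : A) (p : {poly R[i]}).

Lemma spectrum_real a (k : R[i]) : star a = a -> spectrum a k -> (complex.Re k)%:C = k.
Proof.
move=> asa; apply: contra_notP => k0; apply: invertible_sub_nonreal => //.
by apply: contra_notN k0; case: k => re im /= /eqP ->.
Qed.

Lemma spectrum_cnorm a (k : R[i]) : spectrum a k -> cabs k <= cnorm a.
Proof.
by apply: contra_notT; rewrite -ltNge => ak; exact: invertible_sub_alg.
Qed.

(** [a^2 - |a|^2] is the product of [a - |a|] and [a + |a|] and is not invertible, so one of the two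
    factors is not. *)
Lemma spectrum_nonempty a : star a = a -> exists k, spectrum a k.
Proof.
move=> asa; apply: contrapT => /forallNP inv.
have {}inv k : invertible (a - k%:A) by apply: contrapT; exact: inv.
apply: (norm_square_not_invertible asa); set m := cnorm a.
have -> : (m ^+ 2)%:C%:A - a * a = - ((a - m%:C%:A) * (a - (- m%:C)%:A)).
  rewrite scaleNr opprK mulrDr !mulrBl mulr_algr !mulr_algl scalerA.
  by rewrite addrA subrK opprB -rmorphM -expr2.
by apply: invertibleN; apply: invertibleM.
Qed.

Lemma horner_alg_comm a p : horner_alg a p * a = a * horner_alg a p.
Proof. by rewrite -{2 3}(horner_algX a) -!rmorphM commr_polyX. Qed.

Lemma star_horner_alg a p : star a = a ->
  star (horner_alg a p) = horner_alg a (map_poly conjc p).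
Proof.
move=> asa; elim/poly_ind: p => [|p c IH]; first by rewrite !rmorph0 star0.
rewrite !rmorphD !rmorphM /= map_polyX map_polyC /= !horner_algX !horner_algC.
by rewrite starD starMr asa IH star_alg horner_alg_comm.
Qed.

(** Over the algebraically closed [R[i]], [p(a)] is a scalar times a product of factors [a - k] over
    the roots [k], and one of them fails to be invertible. For [p = 0] any point of the spectrum
    will do. *)
Lemma horner_alg_spectrum a p : star a = a -> ~ invertible (horner_alg a p) ->
  exists2 k : R[i], spectrum a k & p.[k] = 0.
Proof.
move=> asa; have [r pE] := closed_field_poly_normal p.
have [c0|c0] := eqVneq (lead_coef p) 0.
  by have [k ak] := spectrum_nonempty asa; exists k; rewrite // pE c0 scale0r horner0.
move=> ninv; have [k kr ak] : exists2 k, k \in r & spectrum a k.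
  apply: contrapT => nr; apply: ninv.
  rewrite pE -mul_polyC rmorphM /= horner_algC mulr_algl; apply: invertibleZ => //.
  have {}nr k : k \in r -> invertible (a - k%:A).
    by move=> kr; apply: contrapT => ak; apply: nr; exists k.
  elim: r nr {pE} => [|k r IH] nr; first by rewrite big_nil rmorph1; exact: invertible1.
  rewrite big_cons rmorphM /= rmorphB /= horner_algX horner_algC.
  apply: invertibleM; first by apply: nr; rewrite inE eqxx.
  by apply: IH => l lr; apply: nr; rewrite inE lr orbT.
exists k => //; apply/eqP; rewrite pE hornerZ mulf_eq0; apply/orP; right.
exact: (etrans (root_prod_XsubC r k)).
Qed.

(** Passing to [q], the product of [p] and its conjugate, makes the element self-adjoint, so
    [norm_square_not_invertible] applies. As [q] equals [|p|^2] on the real spectrum, the norm is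
    even attained there as some [|p.[k]|]. *)
Lemma cnorm_horner_alg_le a p (M : R) : star a = a ->
  (forall k, spectrum a k -> cabs p.[k] <= M) -> cnorm (horner_alg a p) <= M.
Proof.
move=> asa pM; set q := map_poly conjc p * p; set m := cnorm (horner_alg a p) ^+ 2.
have qaE : horner_alg a q = star (horner_alg a p) * horner_alg a p.
  by rewrite rmorphM /= star_horner_alg.
have mE : cnorm (horner_alg a q) = m by rewrite qaE cnorm_starM.
have qsa : star (horner_alg a q) = horner_alg a q by rewrite qaE starMr starK.
(* [|p(a)|^4 - (p^* p)^2] has a root in the spectrum, which is real. *)
have := norm_square_not_invertible qsa.
rewrite mE -(horner_algC a) -rmorphM -rmorphB => /(horner_alg_spectrum asa) [k ak].
rewrite hornerD hornerN hornerC hornerM => /eqP; rewrite subr_eq0 => /eqP.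
have kconj : conjc k = k by rewrite -(spectrum_real asa ak) conjc_real.
have zM : cabs p.[k] <= M by exact: pM.
have z0 : 0 <= cabs p.[k] by rewrite -lecR RRe_ge0 normr_ge0.
have -> : q.[k] = ((cabs p.[k]) ^+ 2)%:C.
  by rewrite hornerM -{1}kconj horner_map /= mulrC -sqr_normc rmorphXn.
rewrite -rmorphM /= => /complexI /eqP; rewrite -expr2 eqrXn2 ?sqr_ge0 //.
by rewrite eqrXn2 ?cnorm_ge0 // => /eqP ->.
Qed.

End Polynomials.

(** * Polynomial approximation of the absolute value *)

Section ClampPolynomials.
Variable R : realType.
Implicit Types (t x e B : R).

(* [y_(n+1) = (1 - t^2 + y_n^2) / 2] increases to [1 - |t|]. *)
Lemma poly_norm_unit e : 0 < e ->
  exists p : {poly R}, forall t, `|t| <= 1 -> `|p.[t] - `|t| | <= e.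
Proof.
move=> e0; pose y n := iter n (fun y : {poly R} => 2^-1 *: (1 - 'X ^+ 2 + y ^+ 2)) 0.
have yS n t : (y n.+1).[t] = (1 - t ^+ 2 + (y n).[t] ^+ 2) / 2.
  by rewrite /y iterS -/(y n) !hornerE mulrC.
(* The error [d] is followed by [d (2 (1 - |t|) - d) / 2 <= d (1 - d / 2)], whence a decay like
   [2 / (n + 1)], uniform in [t]. *)
have yd n t : `|t| <= 1 -> 0 <= 1 - `|t| - (y n).[t] <= 1 - `|t| /\
    n.+1%:R * (1 - `|t| - (y n).[t]) <= 2.
  move=> t1; elim: n => [|n].
    by rewrite /y /= horner0 subr0 lexx subr_ge0 t1 mul1r; split => //; have := normr_ge0 t; lra.
  set d := 1 - `|t| - (y n).[t] => -[/andP[d0 da] nd].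
  have -> : 1 - `|t| - (y n.+1).[t] = d * (2 * (1 - `|t|) - d) / 2.
    by rewrite yS /d -[t ^+ 2]real_normK ?num_real //; field.
  have -> : n.+2%:R = n.+1%:R + 1 :> R by rewrite natr1.
  set N := n.+1%:R in nd *; have := normr_ge0 t.
  move: da t1; set u := `|t| => da t1 u0.
  have N0 : 0 <= N by [].
  have d1 : 0 <= d * (2 * (1 - u) - d) by rewrite mulr_ge0 //; lra.
  have : 0 <= (1 - u - d) ^+ 2 by rewrite sqr_ge0.
  have : 0 <= (1 - u) * u by rewrite mulr_ge0 //; lra.
  split; first by rewrite divr_ge0 //= ler_pdivrMr //; nra.
  have : (N + 1) * (d * (2 * (1 - u) - d)) <= (N + 1) * (d * (2 - d)).
    by rewrite ler_wpM2l ?addr_ge0 // ler_wpM2l //; lra.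
  have : 0 <= (2 - N * d) * (1 - d) by rewrite mulr_ge0 //; lra.
  have : 0 <= d ^+ 2 by rewrite sqr_ge0.
  lra.
exists (1%:P - y (Num.truncn (2 / e)).+1) => t t1; rewrite hornerD hornerN hornerC.
have [/andP[d0 _]] := yd (Num.truncn (2 / e)).+1 t t1.
set d := 1 - _ - _ in d0 *; rewrite -addrA -opprD [_ + `|t|]addrC opprD addrA -/d ger0_norm //.
set n := Num.truncn _; have ne : 2 / e < n.+1%:R by rewrite truncnS_gt.
have : 2 < n.+1%:R * e by rewrite -ltr_pdivrMr.
have -> : n.+2%:R = n.+1%:R + 1 :> R by rewrite natr1.
move=> ne2 nd; rewrite -(@ler_pM2l _ n.+1%:R) //.
set N := n.+1%:R in ne2 nd *; lra.
Qed.

Lemma poly_norm B e : 0 < e ->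
  exists p : {poly R}, forall t, `|t| <= B -> `|p.[t] - `|t| | <= e.
Proof.
move=> e0; have [B0|B0] := leP B 0.
  by exists 0 => t tB; rewrite horner0 sub0r normrN normr_id (le_trans tB) // (le_trans B0) // ltW.
have [p pe] := poly_norm_unit (divr_gt0 e0 B0).
exists (B *: (p \Po (B^-1 *: 'X))) => t tB.
rewrite hornerZ horner_comp hornerZ hornerX.
have tB1 : `|B^-1 * t| <= 1 by rewrite normrM gtr0_norm ?invr_gt0 // mulrC ler_pdivrMr ?mul1r.
have := pe _ tB1; rewrite ler_pdivlMr // -[X in _ * X](gtr0_norm B0) -normrM mulrC.
rewrite mulrBr normrM [X in B * (X * _)]gtr0_norm ?invr_gt0 // mulrA mulfV ?gt_eqF // mul1r //.
Qed.

(** The ramp from 0 to 1 over the unit interval, written with absolute values so that [poly_norm]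
    approximates it. *)
Definition clamp x : R := (`|x| - `|x - 1| + 1) / 2.

Lemma clamp_nondecreasing x t : x <= t -> clamp x <= clamp t.
Proof.
rewrite /clamp => xt.
by case: (ger0P x); case: (ger0P (x - 1)); case: (ger0P t); case: (ger0P (t - 1)); lra.
Qed.

Lemma clamp0 x : x <= 0 -> clamp x = 0.
Proof. by rewrite /clamp => x0; rewrite ler0_norm // ler0_norm; lra. Qed.

Lemma clamp1 x : 1 <= x -> clamp x = 1.
Proof. by rewrite /clamp => x1; rewrite ger0_norm ?ger0_norm; lra. Qed.

Lemma poly_clamp B e : 0 < e ->
  exists p : {poly R}, forall x, `|x| <= B -> `|p.[x] - clamp x| <= e.
Proof.
move=> e0; have [p pe] := poly_norm (B + 1) e0.
exists (2^-1 *: (p - (p \Po ('X - 1%:P)) + 1)) => x xB.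
rewrite !hornerE horner_comp !hornerE /clamp.
have := pe x; have := pe (x - 1).
have xB1 : `|x| <= B + 1 by lra.
have x1B1 : `|x - 1| <= B + 1 by rewrite (le_trans (ler_normB _ _)) // normr1 lerD2r.
move=> /(_ x1B1) h1 /(_ xB1) h2.
move: h1 h2; rewrite !ler_norml; lra.
Qed.

End ClampPolynomials.

(** * The Weierstrass theorem and uniform continuity *)

Section Weierstrass.
Variable R : realType.
Implicit Types (t x e B : R) (k l : R[i]).

Lemma cabsE k : (cabs k)%:C = `|k|.
Proof. by rewrite RRe_ge0. Qed.

Lemma cabs_ge0 k : 0 <= cabs k.
Proof. by rewrite -lecR cabsE normr_ge0. Qed.

Lemma cabsD k l : cabs (k + l) <= cabs k + cabs l.
Proof. by rewrite -lecR rmorphD !cabsE ler_normD. Qed.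

Lemma cabsM k l : cabs (k * l) = cabs k * cabs l.
Proof. by apply: complexI; rewrite rmorphM !cabsE normrM. Qed.

Lemma cabs_distC k l : cabs (k - l) = cabs (l - k).
Proof. by rewrite distrC. Qed.

Lemma cabs_sum (I : Type) (r : seq I) (F : I -> R[i]) :
  cabs (\sum_(i <- r) F i) <= \sum_(i <- r) cabs (F i).
Proof.
rewrite -lecR cabsE rmorph_sum /= (le_trans (ler_norm_sum _ _ _)) //.
Qed.

(* The differences of consecutive translates of [clamp] form a partition of
   unity; each of them is supported in an interval of length [2 d]. *)
Lemma weierstrass (K : set R) B (f : R -> R[i]) :
  (forall t, K t -> `|t| <= B) ->
  (forall e, 0 < e -> exists2 d : R, 0 < d &
     forall s t, K s -> K t -> `|s - t| < d -> cabs (f s - f t) <= e) ->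
  forall e, 0 < e -> exists p : {poly R[i]}, forall t, K t -> cabs (p.[t%:C] - f t) <= e.
Proof.
move=> KB fK e e0; have e20 : 0 < e / 2 by rewrite divr_gt0.
have [d' d'0 fd'] := fK _ e20; pose d := d' / 2; have d0 : 0 < d by rewrite divr_gt0.
pose x t := (t + B) / d.
(* On [K], [x t <= 2 B / d], so [.+2] makes [x t - n + 1] at most 0 and the last translate of
   [clamp] vanish; the first one is 1, so the telescoping sum is 1. *)
pose n := (Num.truncn (2 * B / d)).+2.
pose W (j : nat) t := clamp (x t - j%:R + 1) - clamp (x t - j%:R).
have xn t : K t -> 0 <= x t <= 2 * B / d.
  move=> /KB; rewrite ler_norml => /andP[tB1 tB2].
  by rewrite /x divr_ge0 ?ler_pM2r ?invr_gt0 //; lra.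
have xn1 t : K t -> x t - n%:R + 1 <= 0.
  move=> /xn/andP[_ xB]; have : 2 * B / d < (Num.truncn (2 * B / d)).+1%:R by rewrite truncnS_gt.
  have -> : n%:R = (Num.truncn (2 * B / d)).+1%:R + 1 :> R by rewrite natr1.
  lra.
have W0 j t : 0 <= W j t by rewrite subr_ge0 clamp_nondecreasing // lerDl.
have W1 t : K t -> \sum_(0 <= j < n) W j t = 1.
  move=> Kt; pose G j := - clamp (x t - j%:R + 1).
  have -> : \sum_(0 <= j < n) W j t = \sum_(0 <= j < n) (G j.+1 - G j).
    apply: eq_bigr => j _; rewrite /W /G opprK addrC; congr (- clamp _ + _).
    by rewrite -natr1; ring.
  rewrite telescope_sumr // /G (clamp0 (xn1 _ Kt)) oppr0 add0r opprK addr0 clamp1 //.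
  by rewrite lerDr; case/andP: (xn _ Kt).
have Wnear j t : W j t != 0 -> `|x t - j%:R| < 1.
  apply: contraR; rewrite -leNgt ler_normr => /orP[h|h].
    by rewrite /W !clamp1 ?subrr //; lra.
  by rewrite /W !clamp0 ?subrr //; lra.
(* The values of [f] are controlled on [K] only, so the sample [s j] has to be a point of [K] near
   the center of [W j], if there is one. *)
have [s sP] : exists s : nat -> R, forall j t, K t -> `|x t - j%:R| < 1 ->
    K (s j) /\ `|x (s j) - j%:R| < 1.
  suff /choice[s sP] : forall j : nat, exists u, forall t, K t -> `|x t - j%:R| < 1 ->
    K u /\ `|x u - j%:R| < 1 by exists s.
  move=> j; have [[u [Ku ju]]|nu] := pselect (exists u, K u /\ `|x u - j%:R| < 1).
    by exists u.
  by exists 0 => t Kt jt; case: nu; exists t.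
pose c j := f (s j).
have fW j t : K t -> cabs (c j - f t) * W j t <= e / 2 * W j t.
  move=> Kt; have [->|Wj] := eqVneq (W j t) 0; first by rewrite !mulr0.
  rewrite ler_wpM2r //; have jt := Wnear _ _ Wj; have [Ks js] := sP _ _ Kt jt.
  apply: fd' => //.
  have -> : s j - t = d * ((x (s j) - j%:R) - (x t - j%:R)).
    by rewrite /x; field; rewrite gt_eqF.
  rewrite normrM gtr0_norm // mulrC -ltr_pdivlMr // (le_lt_trans (ler_normB _ _)) //.
  have -> : d' / d = 2 by rewrite /d; field; rewrite gt_eqF.
  lra.
pose C := \sum_(0 <= j < n) cabs (c j).
have C0 : 0 <= C by apply: sumr_ge0 => j _; exact: cabs_ge0.
(* Replacing each [W j] by the polynomial [P j] costs at most [C e1 <= e / 2]; the oscillation of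
   [f] costs the other half. *)
pose e1 := e / 2 / (1 + C).
have e10 : 0 < e1 / 2 by rewrite !divr_gt0 // ltr_wpDr.
have [p pe] := poly_clamp (2 * B / d + n%:R + 1) e10.
pose L (j : nat) : {poly R} := d^-1 *: ('X + B%:P) - j%:R%:P.
have LE j t : (L j).[t] = x t - j%:R.
  by rewrite /L !(hornerD, hornerN, hornerZ, hornerC, hornerX) mulrC.
pose P j := (p \Po (L j + 1%:P)) - (p \Po L j).
have PW j t : K t -> (j < n)%N -> `|(P j).[t] - W j t| <= e1.
  move=> Kt jn; have /andP[x0 xB] := xn _ Kt.
  have jn' : (j%:R : R) <= n%:R by rewrite ler_nat ltnW.
  have j0 : 0 <= j%:R :> R by [].
  rewrite /P hornerD hornerN !horner_comp hornerD hornerC LE /W.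
  have /pe : `|x t - j%:R| <= 2 * B / d + n%:R + 1 by rewrite ler_norml; lra.
  have /pe : `|x t - j%:R + 1| <= 2 * B / d + n%:R + 1 by rewrite ler_norml; lra.
  by rewrite !ler_norml; lra.
exists (\sum_(0 <= j < n) c j *: map_poly (real_complex R) (P j)) => t Kt.
have -> : (\sum_(0 <= j < n) c j *: map_poly (real_complex R) (P j)).[t%:C] - f t =
    \sum_(0 <= j < n) (c j * ((P j).[t] - W j t)%:C + (c j - f t) * (W j t)%:C).
  have fE : f t = \sum_(0 <= j < n) f t * (W j t)%:C.
    by rewrite -mulr_sumr -rmorph_sum /= W1 // mulr1.
  rewrite {1}fE horner_sum -sumrB; apply: eq_bigr => j _.
  rewrite hornerZ horner_map; move: (W j t) (P j).[t] => v u.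
  by rewrite rmorphB mulrBr mulrBl addrA subrK.
rewrite (le_trans (cabs_sum _ _)) //.
have : C * e1 + e / 2 * \sum_(0 <= j < n) W j t <= e.
  rewrite W1 // mulr1 {2}(splitr e) lerD2r /e1 mulrCA -[leRHS]mulr1.
  by rewrite ler_pM2l // ler_pdivrMr ?mul1r ?lerDr ?ler01 // ltr_wpDr.
apply: le_trans; rewrite /C mulr_suml mulr_sumr -big_split /= !big_mkord.
apply: ler_sum => j _; rewrite (le_trans (cabsD _ _)) // !cabsM !Re_norm_real.
rewrite [`|W _ _|]ger0_norm // lerD // ?fW //.
by rewrite ler_wpM2l ?cabs_ge0 // PW.
Qed.

(** Heine-Cantor, which supplies the hypothesis of [weierstrass]. The near-covering form of
    compactness turns radii depending on [t] into a single one; halving [d] leaves room for moving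
    both points. *)
Lemma compact_uniform_continuity (K : set R) (f : R -> R[i]) : compact K ->
  (forall t, K t -> forall e, 0 < e -> exists2 d : R, 0 < d &
     forall s, K s -> `|s - t| < d -> cabs (f s - f t) <= e) ->
  forall e, 0 < e -> exists2 d : R, 0 < d &
     forall s t, K s -> K t -> `|s - t| < d -> cabs (f s - f t) <= e.
Proof.
move=> /compact_near_coveringP cK fc e e0.
pose P (d t : R) := K t -> forall s, K s -> `|s - t| < d -> cabs (f s - f t) <= e.
have : \forall d \near (0 : R)^'+, K `<=` P d.
  apply: cK => t Kt.
  have [d d0 fd] := fc t Kt _ (divr_gt0 e0 (ltr0n _ 2)).
  have d20 : 0 < d / 2 by rewrite divr_gt0.
  exists (ball t (d / 2), [set r | r < d / 2]) => /=.
    split; [exact: nbhsx_ballx | exact: nbhs_right_lt].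
  move=> [t' r] /= [tt' rd] Kt' s Ks st'.
  rewrite -[f s](subrK (f t)) -addrA (le_trans (cabsD _ _)) // (splitr e) lerD //.
    apply: fd => //; rewrite -[s](subrK t') -addrA (le_lt_trans (ler_normD _ _)) //.
    by rewrite (splitr d) ltrD // ?(lt_trans st') // distrC.
  rewrite cabs_distC fd // distrC (lt_trans tt') //.
  lra.
move=> near_d; have [d [d0 Pd]] : exists d : R, 0 < d /\ K `<=` P d.
  near (0 : R)^'+ => d; exists d; split; near: d => //.
  exact: nbhs_right_gt.
by exists d => // s t Ks Kt; exact: Pd.
Unshelve. all: by end_near.
Qed.

End Weierstrass.

(** * The calculus as a limit of polynomials *)

Section FunctionalCalculus.
Variables (R : realType) (A : cstarAlgType R).
Implicit Types (a b c x y : A) (p q : {poly R[i]}) (f h : R[i] -> R[i]) (k l : R[i]).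

Lemma gt0_realE k : 0 < k -> 0 < complex.Re k /\ k = (complex.Re k)%:C.
Proof. by move=> k0; rewrite RRe_ge0 ?ltW // -ltcR RRe_ge0 ?ltW. Qed.

Lemma continuous_on_spectrumP a (f : R[i]^o -> R[i]^o) :
  continuous_on_spectrum a f <->
  forall k, spectrum a k -> forall e, 0 < e -> exists2 d : R, 0 < d &
    forall l, spectrum a l -> cabs (l - k) < d -> cabs (f l - f k) <= e.
Proof.
rewrite /continuous_on_spectrum subspace_continuousP; split=> fc k ak.
  move=> e e0; have e0' : (0 : R[i]) < e%:C by rewrite ltcR.
  have /cvgrPdist_le/(_ _ e0') := fc k ak.
  rewrite near_withinE => /nbhs_ballP[d /gt0_realE[d0 dE] dP].
  exists (complex.Re d) => // l al lk.
  have kl : ball (k : R[i]^o) d l.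
    by rewrite -ball_normE /= distrC dE -cabsE ltcR.
  by have := dP l kl al; rewrite -cabsE lecR distrC.
apply/cvgrPdist_le => e /gt0_realE[e0 eE].
have [d d0 dP] := fc k ak _ e0.
rewrite near_withinE; apply/nbhs_ballP; exists d%:C => /=; first by rewrite ltcR.
move=> l; rewrite -ball_normE /= -cabsE ltcR distrC => lk al.
by rewrite eE -cabsE lecR distrC; exact: dP.
Qed.

Lemma invertible_open x : invertible x ->
  exists2 d : R, 0 < d & forall y, cnorm (x - y) < d -> invertible y.
Proof.
move=> [u [xu ux]]; have u1 : 0 < 1 + cnorm u by rewrite ltr_wpDr // cnorm_ge0.
exists (1 + cnorm u)^-1; first by rewrite invr_gt0.
move=> y xy; have -> : y = x * (1 - u * (x - y)).
  by rewrite mulrBr mulr1 mulrA xu mul1r subKr.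
apply: invertibleM; first by exists u.
apply: neumann; rewrite (le_lt_trans (cnormM _ _)) //.
move: xy; rewrite -[ltRHS]mul1r ltr_pdivlMr // => xy.
by apply: le_lt_trans xy; rewrite mulrC ler_wpM2l ?cnorm_ge0 // lerDr.
Qed.

Definition real_spectrum a : set R := [set t | spectrum a t%:C].

Lemma real_spectrum_compact a : compact (real_spectrum a).
Proof.
apply: (@subclosed_compact _ _ `[- cnorm a, cnorm a]); last 2 first.
- exact: segment_compact.
- by move=> t /spectrum_cnorm; rewrite Re_norm_real /= in_itv /= ler_norml.
rewrite -[real_spectrum a]setCK; apply: open_closedC; rewrite openE => t /= at_.
have {at_} /invertible_open[d d0 dP] : invertible (a - t%:C%:A) by apply: contrapT.
apply/nbhs_ballP; exists d => //= s; rewrite -ball_normE /= => ts; apply; apply: dP.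
by rewrite opprB addrC addrA subrK -scalerBl -rmorphB cnorm_real_alg distrC.
Qed.

(** The pairs [(f, b)] in the closure of the graph of [p |-> p(a)], for the sup norm on the
    spectrum. A single [p] approximates both, so each law is checked on polynomials. *)
Definition approx_calculus a f b := forall e, 0 < e -> exists p,
  (forall k, spectrum a k -> cabs (p.[k] - f k) <= e) /\ cnorm (horner_alg a p - b) <= e.

Lemma poly_bounded p (B : R) : exists C : R, forall k, cabs k <= B -> cabs p.[k] <= C.
Proof.
elim/poly_ind: p => [|p c [C CP]].
  by exists 0 => k _; rewrite horner0 normr0.
exists (C * B + cabs c) => k kB; rewrite hornerMXaddC (le_trans (cabsD _ _)) // lerD2r.
by rewrite cabsM ler_pM ?cabs_ge0 // CP.
Qed.

Lemma approx_calculus_bounded a f b : approx_calculus a f b ->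
  exists2 C : R, 0 <= C & forall k, spectrum a k -> cabs (f k) <= C.
Proof.
move=> /(_ 1 ltr01)[p [pf _]]; have [C CP] := poly_bounded p (cnorm a).
exists (`|C| + 1) => [|k ak]; first by rewrite addr_ge0.
rewrite -[f k](subKr p.[k]).
rewrite (le_trans (cabsD _ _)) // lerD //.
  by rewrite (le_trans (CP _ (spectrum_cnorm ak))) // ler_norm.
by rewrite normrN; exact: pf.
Qed.

(** On the spectrum the two approximating polynomials differ by at most [e / 2], and
    [cnorm_horner_alg_le] carries this over to their values at [a]. *)
Lemma approx_calculus_unique a f h b c : star a = a ->
  approx_calculus a f b -> approx_calculus a h c ->
  (forall k, spectrum a k -> f k = h k) -> b = c.
Proof.
move=> asa fb hc fh; apply/eqP; rewrite -subr_eq0; apply/eqP/cnorm_eq0/eqP.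
rewrite eq_le cnorm_ge0 andbT; apply/ler_addgt0Pr => e e0; rewrite add0r.
have e40 : 0 < e / 4 by rewrite divr_gt0.
have [p [pf pb]] := fb _ e40; have [q [qh qc]] := hc _ e40.
have pq : cnorm (horner_alg a (p - q)) <= e / 4 + e / 4.
  apply: cnorm_horner_alg_le => // k ak.
  rewrite hornerD hornerN -(subrKA (f k)) (le_trans (cabsD _ _)) // lerD ?pf //.
  by rewrite cabs_distC fh // qh.
have -> : b - c = - (horner_alg a p - b) + (horner_alg a (p - q) + (horner_alg a q - c)).
  by rewrite rmorphB /= opprB !subrKA.
rewrite (le_trans (cnormD _ _)) // cnormN (le_trans (lerD pb (cnormD _ _))) //.
lra.
Qed.

(** The spectrum is real and compact, so Weierstrass polynomials converge to [f] uniformly on it;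
    the norm bound makes their values at [a] a Cauchy sequence. *)
Lemma approx_calculus_exists a f : star a = a -> continuous_on_spectrum a f ->
  exists b, approx_calculus a f b.
Proof.
move=> asa /continuous_on_spectrumP fc.
have fw : forall e, 0 < e -> exists p, forall k, spectrum a k -> cabs (p.[k] - f k) <= e.
  move=> e e0.
  have [| |p pf] := @weierstrass R (real_spectrum a) (cnorm a) (fun t => f t%:C) _ _ e e0.
  - by move=> t /spectrum_cnorm; rewrite Re_norm_real.
  - apply: (@compact_uniform_continuity R (real_spectrum a) (fun t => f t%:C)).
      exact: real_spectrum_compact.
    move=> t at_ e' e'0.
    have [d d0 dP] := fc _ at_ _ e'0; exists d => // s as_ st.
    by apply: dP => //; rewrite -rmorphB Re_norm_real.
  - exists p => k ak; rewrite -(spectrum_real asa ak); apply: pf.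
    by rewrite /real_spectrum /= (spectrum_real asa ak).
have inv0 (n : nat) : (0 : R) < n.+1%:R^-1 by rewrite invr_gt0.
have [p pf] := choice (fun n => fw _ (inv0 n)).
have small e : 0 < e -> exists n, forall m, (n <= m)%N -> m.+1%:R^-1 <= e :> R.
  move=> e0; exists (Num.truncn e^-1) => m nm.
  rewrite invf_ple ?posrE // ltW // (lt_le_trans (truncnS_gt _)) // ler_nat ltnS //.
have pq n m : cnorm (horner_alg a (p n) - horner_alg a (p m)) <= n.+1%:R^-1 + m.+1%:R^-1.
  rewrite -rmorphB; apply: cnorm_horner_alg_le => // k ak.
  rewrite hornerD hornerN -(subrKA (f k)) (le_trans (cabsD _ _)) // lerD ?pf //.
  by rewrite cabs_distC pf.
have [|b pb] := @cnorm_complete _ _ (fun n => horner_alg a (p n)).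
  move=> e e0; have [n nP] := small _ (divr_gt0 e0 (ltr0n _ 2)).
  exists n => m m' nm nm'; rewrite (le_trans (pq _ _)) // [leRHS](splitr e) lerD ?nP //.
exists b => e e0; have [n nP] := small _ e0; have [m mP] := pb _ e0.
exists (p (maxn n m)); split; last by apply: mP; exact: leq_maxr.
by move=> k ak; rewrite (le_trans (pf _ _ ak)) // nP // leq_maxl.
Qed.

Lemma approx_calculusD a f h b c : approx_calculus a f b -> approx_calculus a h c ->
  approx_calculus a (fun k => f k + h k) (b + c).
Proof.
move=> fb hc e e0; have e20 : 0 < e / 2 by rewrite divr_gt0.
have [p [pf pb]] := fb _ e20; have [q [qh qc]] := hc _ e20.
exists (p + q); split => [k ak|].
  by rewrite hornerD opprD addrACA (splitr e) (le_trans (cabsD _ _)) // lerD ?pf ?qh.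
by rewrite rmorphD /= opprD addrACA (splitr e) (le_trans (cnormD _ _)) // lerD.
Qed.

Lemma approx_calculusM a f h b c : star a = a ->
  approx_calculus a f b -> approx_calculus a h c ->
  approx_calculus a (fun k => f k * h k) (b * c).
Proof.
move=> asa fb hc e e0.
have [C1 C10 fC] := approx_calculus_bounded fb.
have [C2 C20 hC] := approx_calculus_bounded hc.
pose C := C1 + C2 + cnorm b + cnorm c + 1.
have b0 := cnorm_ge0 b; have c0 := cnorm_ge0 c.
have C0 : 0 < C by rewrite /C; lra.
(* [d <= 1] keeps the approximants below [C], and [d <= e / (2 C)] bounds each of the two error
   terms by [e / 2]. *)
pose d := Num.min 1 (e / (2 * C)).
have d0 : 0 < d by rewrite lt_min ltr01 divr_gt0 // mulr_gt0.
have d1 : d <= 1 by rewrite ge_min lexx.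
have dC : d * C + C * d <= e.
  have : d <= e / (2 * C) by rewrite ge_min lexx orbT.
  by rewrite ler_pdivlMr ?mulr_gt0 //; lra.
have [p [pf pb]] := fb _ d0; have [q [qh qc]] := hc _ d0.
exists (p * q); split => [k ak|].
  have -> : (p * q).[k] - f k * h k = (p.[k] - f k) * q.[k] + f k * (q.[k] - h k).
    by rewrite hornerM mulrBl mulrBr addrA subrK.
  apply: le_trans dC; rewrite (le_trans (cabsD _ _)) // !cabsM lerD //.
    rewrite ler_pM ?cabs_ge0 ?pf // -[q.[k]](subrK (h k)) (le_trans (cabsD _ _)) //.
    by have := qh _ ak; have := hC _ ak; rewrite /C; lra.
  by rewrite ler_pM ?cabs_ge0 ?qh //; have := fC _ ak; rewrite /C; lra.
rewrite rmorphM /=.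
have -> : horner_alg a p * horner_alg a q - b * c =
    (horner_alg a p - b) * horner_alg a q + b * (horner_alg a q - c).
  by rewrite mulrBl mulrBr addrA subrK.
apply: le_trans dC; rewrite (le_trans (cnormD _ _)) // lerD // (le_trans (cnormM _ _)) //.
  rewrite ler_pM ?cnorm_ge0 // -[horner_alg a q](subrK c) (le_trans (cnormD _ _)) //.
  by rewrite /C; lra.
by rewrite ler_pM ?cnorm_ge0 // /C; lra.
Qed.

Lemma approx_calculus_conj a f b : star a = a -> approx_calculus a f b ->
  approx_calculus a (fun k => conjc (f k)) (star b).
Proof.
move=> asa fb e e0; have [p [pf pb]] := fb _ e0.
exists (map_poly conjc p); split => [k ak|].
  have kk : conjc k = k by rewrite -(spectrum_real asa ak) conjc_real.
  by rewrite -{1}kk horner_map -rmorphB [`|_|]normcJ pf.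
by rewrite -star_horner_alg // -starB cnorm_star.
Qed.

Lemma approx_calculus_poly a p : approx_calculus a (fun k => p.[k]) (horner_alg a p).
Proof.
by move=> e e0; exists p; split => [k _|]; rewrite subrr ?normr0 ?cnorm0 ltW.
Qed.

Lemma approx_calculus_cst a k : approx_calculus a (fun=> k) k%:A.
Proof.
rewrite -(horner_algC a); have := approx_calculus_poly a k%:P.
by congr approx_calculus; apply/funext => l; rewrite hornerC.
Qed.

Lemma functional_calculus_exists a : star a = a -> exists Phi, functional_calculus a Phi.
Proof.
(* Where nothing approximates [f] the value is the default 0; the laws concern only functions
   continuous on the spectrum. *)
move=> asa; exists (fun f => xget 0 [set b | approx_calculus a f b]).
set Phi := fun f => _.
have PhiE f b : approx_calculus a f b -> Phi f = b.
  move=> fb; have fPhi : approx_calculus a f (Phi f) by exact: (xgetI 0 fb).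
  exact: approx_calculus_unique fPhi fb _.
have PhiP f : continuous_on_spectrum a f -> approx_calculus a f (Phi f).
  by move=> /(approx_calculus_exists asa)[b fb]; rewrite (PhiE _ _ fb).
split.
- move=> f h cf ch fh; exact: approx_calculus_unique (PhiP _ cf) (PhiP _ ch) fh.
- split.
  + by move=> f h cf ch; apply: PhiE; apply: approx_calculusD; exact: PhiP.
  + move=> k f cf; apply: PhiE; rewrite -mulr_algl; apply: approx_calculusM => //.
      exact: approx_calculus_cst.
    exact: PhiP.
  + by move=> f h cf ch; apply: PhiE; apply: approx_calculusM => //; exact: PhiP.
  + by move=> f cf; apply: PhiE; apply: approx_calculus_conj => //; exact: PhiP.
- by rewrite (PhiE _ _ (approx_calculus_cst a 1)) scale1r.
- apply: PhiE; rewrite -[X in approx_calculus _ _ X]horner_algX.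
  have := approx_calculus_poly a 'X.
  by congr approx_calculus; apply/funext => l; rewrite hornerX.
Qed.

End FunctionalCalculus.

(** * Jensen and Cauchy-Schwarz inequalities for states *)

Section Convex.
Variable R : realType.
Implicit Types (F : R -> R) (t x y c : R).

Lemma convex_functionP F t x y : @convex_function R R^o `[0, +oo[ F ->
  0 <= x -> 0 <= y -> 0 <= t -> t <= 1 ->
  F (t * x + (1 - t) * y) <= t * F x + (1 - t) * F y.
Proof.
move=> cF x0 y0 t0 t1.
have := cF (Itv01 t0 t1) x y; rewrite !convRE /=; apply; rewrite inE /= in_itv /= andbT //.
Qed.

Lemma convex_three_chords F x t y : @convex_function R R^o `[0, +oo[ F ->
  0 <= x -> x < t -> t < y -> (F t - F x) / (t - x) <= (F y - F t) / (y - t).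
Proof.
move=> cF x0 xt ty; have yx : 0 < y - x by lra.
have tE : t = (y - t) / (y - x) * x + (1 - (y - t) / (y - x)) * y.
  by field; rewrite gt_eqF.
have : F t <= (y - t) / (y - x) * F x + (1 - (y - t) / (y - x)) * F y.
  rewrite {1}tE; apply: convex_functionP => //; try lra.
    by rewrite divr_ge0 //; lra.
  by rewrite ler_pdivrMr //; lra.
have -> : (y - t) / (y - x) * F x + (1 - (y - t) / (y - x)) * F y =
    ((y - t) * F x + (t - x) * F y) / (y - x) by field; rewrite gt_eqF.
rewrite ler_pdivlMr // => h.
rewrite ler_pdivrMr ?subr_gt0 // mulrAC ler_pdivlMr ?subr_gt0 //; lra.
Qed.

(** The slope is the supremum of the slopes of chords to the left of [t], which exist as [0 < t];
    every chord to the right is at least as steep. *)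
Lemma convex_supporting_line F t : @convex_function R R^o `[0, +oo[ F -> 0 < t ->
  exists c, forall y, 0 <= y -> F t + c * (y - t) <= F y.
Proof.
move=> cF t0; pose S := [set (F t - F x) / (t - x) | x in [set x | 0 <= x < t]].
have S_ub y : t < y -> ubound S ((F y - F t) / (y - t)).
  by move=> ty _ [x /andP[x0 xt] <-]; exact: convex_three_chords.
have S_sup : has_sup S.
  split; first by exists ((F t - F 0) / (t - 0)), 0 => //=; rewrite lexx.
  by exists ((F (t + 1) - F t) / (t + 1 - t)); apply: S_ub; rewrite ltrDl.
exists (sup S) => y y0; have [yt|ty|->] := ltgtP y t.
- have : (F t - F y) / (t - y) <= sup S.
    by apply: ub_le_sup; [exact: S_sup.2 | exists y => //=; rewrite y0].
  by rewrite ler_pdivrMr ?subr_gt0 //; lra.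
- have : sup S <= (F y - F t) / (y - t) by apply: ge_sup (S_ub _ ty); exact: S_sup.1.
  by rewrite ler_pdivlMr ?subr_gt0 //; lra.
- by rewrite subrr mulr0 addr0.
Qed.

Lemma convex_midpoint F x y : @convex_function R R^o `[0, +oo[ F ->
  0 <= x -> 0 <= y -> F ((x + y) / 2) <= (F x + F y) / 2.
Proof.
move=> cF x0 y0; have := @convex_functionP F 2^-1 x y cF x0 y0.
have -> : 2^-1 * x + (1 - 2^-1) * y = (x + y) / 2 by field.
have -> : 2^-1 * F x + (1 - 2^-1) * F y = (F x + F y) / 2 by field.
by apply; lra.
Qed.

Lemma within_powR_continuous (r : R) : 0 < r ->
  {within `[0, +oo[, continuous (fun t : R => t `^ r)}.
Proof.
move=> r0; apply/continuous_within_itvcyP; split.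
  move=> x x0; apply: differentiable_continuous; apply/derivable1_diffP.
  exact: derivable_powR.
by rewrite powR0 ?gt_eqF //; exact: powR_cvg0.
Qed.

Lemma within_continuous_dist F (D : set R) : {within D, continuous F} ->
  forall t, D t -> forall e, 0 < e ->
  exists2 d : R, 0 < d & forall s, D s -> `|s - t| < d -> `|F s - F t| <= e.
Proof.
move=> /subspace_continuousP cF t Dt e e0.
have /cvgrPdist_le/(_ _ e0) := cF t Dt.
rewrite near_withinE => /nbhs_ballP[d d0 dP]; exists d => // s Ds st.
by rewrite distrC; apply: dP => //; rewrite -ball_normE /= distrC.
Qed.

End Convex.

(** * Functional calculus of positive elements *)

Section PositiveCalculus.
Variables (R : realType) (A : cstarAlgType R).
Implicit Types (a b x y w z : A) (F : R -> R) (k l : R[i]) (t : R).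

Lemma cabs_Re k : `|complex.Re k| <= cabs k.
Proof. by rewrite -lecR cabsE normc_ge_Re. Qed.

Lemma continuous_on_spectrum_real a F : cpos a ->
  {within `[0, +oo[, continuous F} ->
  continuous_on_spectrum a (fun l => (F (complex.Re l))%:C).
Proof.
move=> apos cF; apply/continuous_on_spectrumP => k ak e e0.
have Re0 l : spectrum a l -> `[0, +oo[%classic (complex.Re l).
  by move=> /(cpos_spectrum apos); rewrite lecE /= in_itv /= andbT => /andP[].
have [d d0 dP] := within_continuous_dist cF (Re0 _ ak) e0.
exists d => // l al lk; rewrite -rmorphB Re_norm_real; apply: dP; first exact: Re0.
by apply: le_lt_trans lk; rewrite -raddfB cabs_Re.
Qed.

Lemma continuous_on_spectrum_affine a k l : continuous_on_spectrum a (fun m => k * m + l).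
Proof.
apply/continuous_on_spectrumP => m am e e0.
have k1 : 0 < 1 + cabs k by rewrite ltr_wpDr // cabs_ge0.
exists (e / (1 + cabs k)) => [|m' am' mm']; first by rewrite divr_gt0.
rewrite opprD addrACA subrr addr0 -mulrBr cabsM.
move: mm'; rewrite ltr_pdivlMr // => mm'; apply: le_trans (ltW mm').
by rewrite mulrC ler_wpM2l ?cabs_ge0 // lerDr.
Qed.

Lemma functional_calculus_affine a Phi k l : functional_calculus a Phi ->
  Phi (fun m => k * m + l) = k *: a + l%:A.
Proof.
move=> [ext [PhiD PhiZ _ _] Phi1 Phiid].
have cid : continuous_on_spectrum a id.
  have -> : id = (fun m : R[i] => 1 * m + 0) by apply/funext => m; rewrite mul1r addr0.
  exact: continuous_on_spectrum_affine.
have ccst m' : continuous_on_spectrum a (fun=> m').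
  have -> : (fun=> m') = (fun m : R[i] => 0 * m + m') by apply/funext => m; rewrite mul0r add0r.
  exact: continuous_on_spectrum_affine.
have clin : continuous_on_spectrum a (fun m => k * m).
  have -> : (fun m => k * m) = (fun m : R[i] => k * m + 0) by apply/funext => m; rewrite addr0.
  exact: continuous_on_spectrum_affine.
have -> : Phi (fun m => k * m + l) = Phi (fun m => k * m) + Phi (fun=> l).
  exact: PhiD clin (ccst l).
have -> : Phi (fun m => k * m) = k *: Phi id by exact: PhiZ cid.
have := PhiZ l (fun=> 1) (ccst 1); rewrite mulr1 => ->.
by rewrite Phi1 Phiid.
Qed.

Lemma continuous_on_spectrum_ext a (f h : R[i] -> R[i]) :
  (forall k, spectrum a k -> f k = h k) ->
  continuous_on_spectrum a f -> continuous_on_spectrum a h.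
Proof.
move=> fh /continuous_on_spectrumP cf; apply/continuous_on_spectrumP => k ak e e0.
have [d d0 dP] := cf k ak e e0; exists d => // l al lk.
by rewrite -!fh //; exact: dP.
Qed.

Lemma functional_calculus_cpos a Phi F : functional_calculus a Phi -> cpos a ->
  {within `[0, +oo[, continuous F} -> (forall t, 0 <= t -> 0 <= F t) ->
  cpos (Phi (fun l => (F (complex.Re l))%:C)).
Proof.
move=> [ext [_ _ PhiM Phistar] _ _] apos cF F0.
have csF : {within `[0, +oo[, continuous (fun t => Num.sqrt (F t))}.
  by move=> t; apply: (continuous_comp (cF t)); exact: sqrt_continuous.
have cont := continuous_on_spectrum_real apos csF.
have FE l : spectrum a l -> (F (complex.Re l))%:C =
    (Num.sqrt (F (complex.Re l)))%:C * (Num.sqrt (F (complex.Re l)))%:C.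
  move=> /(cpos_spectrum apos); rewrite lecE /= => /andP[_ l0].
  by rewrite -rmorphM -expr2 sqr_sqrtr // F0.
exists (Phi (fun l => (Num.sqrt (F (complex.Re l)))%:C)).
  rewrite -Phistar //; congr Phi; apply/funext => l; exact: conjc_real.
rewrite -PhiM //; apply: (ext _ _ _ _ FE).
  exact: continuous_on_spectrum_real.
exact: continuous_on_spectrum_ext FE (continuous_on_spectrum_real apos cF).
Qed.

(** Existence of a calculus excludes the default value of [xget], but the calculus behind [rcfc]
    remains an arbitrary one. *)
Lemma rcfcE a F : cpos a -> {within `[0, +oo[, continuous F} ->
  exists2 Phi, functional_calculus a Phi &
    rcfc F a = Phi (fun l => (F (complex.Re l))%:C).
Proof.
move=> apos cF; rewrite /rcfc /cfc.
set P := [set b | _].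
have [Phi PhiP] := functional_calculus_exists (cpos_selfadjoint apos).
suff : P (xget 0 P) by move=> [_ [Phi' Phi'P ->]]; exists Phi'.
apply: (@xgetI _ 0 P (Phi (fun l => (F (complex.Re l))%:C))).
by split; [exact: continuous_on_spectrum_real | exists Phi].
Qed.

Lemma rcfc_cpos a F : cpos a -> {within `[0, +oo[, continuous F} ->
  (forall t, 0 <= t -> 0 <= F t) -> cpos (rcfc F a).
Proof.
by move=> apos cF F0; have [Phi PhiP ->] := rcfcE apos cF; exact: (functional_calculus_cpos PhiP).
Qed.

End PositiveCalculus.

(** * Inequalities for a fixed state *)

Section States.
Variables (R : realType) (A : cstarAlgType R).
Variables (g : {linear A -> R[i]^o}) (gstate : state g).
Implicit Types (a b x y w z : A) (F : R -> R) (k l : R[i]) (t : R).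

Let G x : R[i] := g x.

Lemma state_starM_ge0 x : 0 <= G (star x * x).
Proof. by case: gstate => _ + _; apply. Qed.

Lemma state1 : G 1 = 1.
Proof. by case: gstate. Qed.

Lemma stateD x y : G (x + y) = G x + G y.
Proof. exact: raddfD. Qed.

Lemma stateB x y : G (x - y) = G x - G y.
Proof. exact: raddfB. Qed.

Lemma stateZ k x : G (k *: x) = k * G x.
Proof. exact: linearZ. Qed.

Lemma state_cpos a : cpos a -> 0 <= complex.Re (G a) /\ G a = (complex.Re (G a))%:C.
Proof.
move=> [j jsa ->]; have := state_starM_ge0 j; rewrite jsa => g0.
by split; [rewrite -lecR RRe_ge0|rewrite RRe_ge0].
Qed.

(** [|a| - a] is positive by the norm criterion with [T = |a|], because subtracting it from [|a|]
    leaves [a]. *)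
Lemma state_le_cnorm a : cpos a -> complex.Re (G a) <= cnorm a.
Proof.
move=> apos; have [a0|a0] := eqVneq (cnorm a) 0.
  by rewrite a0 (cnorm_eq0 a0) /G raddf0.
have na : 0 < cnorm a by rewrite lt_neqAle eq_sym a0 cnorm_ge0.
have : cpos ((cnorm a)%:C%:A - a).
  apply: (cnorm_cpos _ na); first by rewrite starB starZr star1 cpos_selfadjoint.
  by rewrite subKr.
move=> /state_cpos[+ _]; rewrite stateB stateZ state1 mulr1.
by rewrite raddfB /= subr_ge0.
Qed.

Lemma state_jensen a F : cpos a -> {within `[0, +oo[, continuous F} ->
  @convex_function R R^o `[0, +oo[ F -> F 0 = 0 -> (forall t, 0 <= t -> 0 <= F t) ->
  F (complex.Re (G a)) <= complex.Re (G (rcfc F a)).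
Proof.
move=> apos cF convF F00 F0; have [ga0 gaE] := state_cpos apos.
set t := complex.Re (G a) in ga0 gaE *.
have [c ct] : exists c : R, forall y : R, 0 <= y -> F t + c * (y - t) <= F y.
  (* At [t = 0] there is no chord to the left, but the horizontal axis supports [F], as
     [F 0 = 0 <= F]. *)
  have [t0|t0] := eqVneq t 0.
    by exists 0 => y y0; rewrite t0 F00 mul0r addr0 F0.
  by apply: convex_supporting_line => //; rewrite lt_neqAle eq_sym t0.
have [Phi PhiP ->] := rcfcE apos cF.
(* Since [g a = t] and [g 1 = 1], the supporting line evaluated at [a] is sent to [F t];
   nonnegativity of [g] on the gap [D] is then the claim. *)
pose D (y : R) := F y - (F t + c * (y - t)).
have cD : {within `[0, +oo[, continuous D}.
  apply: within_continuousB cF _; apply: continuous_subspaceT => y.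
  apply: cvgD; first exact: cvg_cst.
  apply: cvgM; first exact: cvg_cst.
  by apply: cvgB; [exact: cvg_id|exact: cvg_cst].
have := functional_calculus_cpos PhiP apos cD _ => /(_ _)/state_cpos[|+ _].
  by move=> y /ct; rewrite /D subr_ge0.
have -> : Phi (fun l => (D (complex.Re l))%:C) =
    Phi (fun l => (F (complex.Re l))%:C) - (c%:C *: a + (F t - c * t)%:C%:A).
  have PhiA := functional_calculus_affine (- c%:C) (- (F t - c * t)%:C) PhiP.
  have [ext [PhiD _ _ _] _ _] := PhiP.
  have DE l : spectrum a l -> (D (complex.Re l))%:C =
      (F (complex.Re l))%:C + (- c%:C * l + - (F t - c * t)%:C).
    move=> /(cpos_spectrum apos)/ger0_Im; case: l => u v /= ->.
    by apply/eqP; rewrite eq_complex /= /D; apply/andP; split; apply/eqP; ring.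
  have cD' := continuous_on_spectrum_real apos cD.
  have cF' := continuous_on_spectrum_real apos cF.
  have -> : - (c%:C *: a + (F t - c * t)%:C%:A) =
      Phi (fun l => - c%:C * l + - (F t - c * t)%:C) by rewrite PhiA opprD !scaleNr.
  rewrite -(PhiD _ _ cF'); last exact: continuous_on_spectrum_affine.
  exact: ext cD' (continuous_on_spectrum_ext DE cD') DE.
rewrite stateB stateD !stateZ state1 mulr1 gaE -rmorphM -rmorphD raddfB /=.
lra.
Qed.

(* The discriminant inequality for a positive Hermitian form, evaluated on the
   line [l |-> p + l q]. *)
Lemma discriminant_le (P Q : R) (c c' : R[i]) : 0 <= P -> 0 <= Q ->
  (forall l : R[i], 0 <= P%:C + l * c + conjc l * c' + (l * conjc l) * Q%:C) ->
  cabs c ^+ 2 <= P * Q.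
Proof.
move=> P0 Q0 form.
(* Being [>= 0] in [R[i]] includes being real, and this at [l = 1] and [l = i] determines [c']. *)
have c'E : c' = conjc c.
  have := form 1; have := form 'i%C.
  case: c {form} => u v; case: c' => u' v'.
  rewrite !lecE /= => /andP[/eqP h1 _] /andP[/eqP h2 _].
  by apply/eqP; rewrite eq_complex /=; apply/andP; split; apply/eqP; lra.
have quad s : 0 <= P - 2 * s * cabs c ^+ 2 + s ^+ 2 * cabs c ^+ 2 * Q.
  have := form (- s%:C * conjc c); rewrite c'E.
  have cc : c * conjc c = (cabs c ^+ 2)%:C by rewrite -sqr_normc rmorphXn.
  have -> : P%:C + - s%:C * conjc c * c + conjc (- s%:C * conjc c) * conjc c +
      - s%:C * conjc c * conjc (- s%:C * conjc c) * Q%:C =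
      (P - 2 * s * cabs c ^+ 2 + s ^+ 2 * cabs c ^+ 2 * Q)%:C.
    have -> : conjc (- s%:C * conjc c) = - s%:C * c.
      case: c {form c'E cc} => u v; apply/eqP.
      by rewrite eq_complex /=; apply/andP; split; apply/eqP; ring.
    move: (cabs c ^+ 2) (conjc c) cc => n2 d cc.
    have -> : (P - 2 * s * n2 + s ^+ 2 * n2 * Q)%:C =
        P%:C - 2 * s%:C * n2%:C + s%:C ^+ 2 * n2%:C * Q%:C.
      by rewrite !(rmorphD, rmorphN, rmorphM, rmorphXn, rmorph_nat).
    rewrite -cc; ring.
  by rewrite ler0c.
have [Q00|Q00] := eqVneq Q 0.
  (* For [Q = 0] the expression is affine in [s], and this [s] would give it the value -1 unless
     [c = 0]. *)
  rewrite Q00 mulr0; have := quad ((P + 1) / 2 / cabs c ^+ 2).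
  have [->|c0] := eqVneq (cabs c ^+ 2) 0; first by [].
  rewrite Q00 mulr0 addr0.
  have -> : 2 * ((P + 1) / 2 / cabs c ^+ 2) * cabs c ^+ 2 = P + 1 by field; rewrite -sqrf_eq0.
  lra.
have Qgt0 : 0 < Q by rewrite lt_neqAle eq_sym Q00.
(* The minimizer of the quadratic in [s]. *)
have := quad Q^-1.
have -> : P - 2 * Q^-1 * cabs c ^+ 2 + Q^-1 ^+ 2 * cabs c ^+ 2 * Q =
   P - cabs c ^+ 2 / Q by field.
by rewrite subr_ge0 ler_pdivrMr.
Qed.

Lemma state_cauchy_schwarz x w z y :
  cabs (G (star x * w + star z * y)) ^+ 2 <=
  (complex.Re (G (star x * x)) + complex.Re (G (star z * z))) *
  (complex.Re (G (star w * w)) + complex.Re (G (star y * y))).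
Proof.
have Gr u : 0 <= complex.Re (G (star u * u)) /\ (complex.Re (G (star u * u)))%:C = G (star u * u).
  by have [h1 h2] := state_cpos (cpos_starM u); split.
have [x0 xE] := Gr x; have [w0 wE] := Gr w; have [y0 yE] := Gr y; have [z0 zE] := Gr z.
apply: (@discriminant_le _ _ _ (G (star w * x + star y * z))).
- exact: addr_ge0.
- exact: addr_ge0.
move=> l.
have expand u v : G (star (u + l *: v) * (u + l *: v)) =
    G (star u * u) + l * G (star u * v) + conjc l * G (star v * u) + l * conjc l * G (star v * v).
  have -> : star (u + l *: v) * (u + l *: v) =
      star u * u + l *: (star u * v) + conjc l *: (star v * u) + (l * conjc l) *: (star v * v).
    rewrite starD starZ mulrDr !mulrDl -!scalerAr -!scalerAl scalerA.
    by rewrite addrACA addrA.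
  by rewrite !stateD !stateZ.
have := addr_ge0 (state_starM_ge0 (x + l *: w)) (state_starM_ge0 (z + l *: y)).
have -> : (complex.Re (G (star x * x)) + complex.Re (G (star z * z)))%:C =
    G (star x * x) + G (star z * z) by rewrite -[in RHS]xE -[in RHS]zE rmorphD.
have -> : (complex.Re (G (star w * w)) + complex.Re (G (star y * y)))%:C =
    G (star w * w) + G (star y * y) by rewrite -[in RHS]wE -[in RHS]yE rmorphD.
by rewrite !expand !stateD; congr (0 <= _); ring.
Qed.

End States.

(** * From states to the numerical radius *)

Section Bound.
Variables (R : realType) (A : cstarAlgType R).
Implicit Types (a b x y w z : A) (phi : R -> R).

(** Jensen's inequality serves twice, for [phi] at [a] and for the power [r] at [phi(a)], and
    midpoint convexity of both functions handles the mean. The norm bounds the state, and the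
    exponent [r^-1] undoes the power. *)
Lemma state_convex_bound (g : {linear A -> R[i]^o}) phi (r : R) a b :
  state g -> orlicz phi -> 1 <= r -> cpos a -> cpos b ->
  phi ((complex.Re (g a) + complex.Re (g b)) / 2) <=
  cnorm (2^-1 *: (rcfc (fun t : R => t `^ r) (rcfc phi a) +
                  rcfc (fun t : R => t `^ r) (rcfc phi b))) `^ r^-1.
Proof.
move=> gstate [phi0 cphi convphi monphi [phi00 _ _]] r1 apos bpos.
have r0 : 0 < r by lra.
have rge0 := ltW r0.
have cpow := within_powR_continuous r0.
have pow0 (t : R) : 0 <= t -> 0 <= t `^ r by move=> _; exact: powR_ge0.
have pow00 : 0 `^ r = 0 :> R by rewrite powR0 // gt_eqF.
set X := fun a => rcfc (fun t : R => t `^ r) (rcfc phi a).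
have phipos (c : A) : cpos c -> cpos (rcfc phi c) by move=> cp; exact: rcfc_cpos.
have Xpos (c : A) : cpos c -> cpos (X c) by move=> cp; apply: rcfc_cpos => //; exact: phipos.
have XP (c : A) : cpos c -> phi (complex.Re (g c)) `^ r <= complex.Re (g (X c)).
  move=> cp; have [gc0 _] := state_cpos gstate cp.
  have [gp0 _] := state_cpos gstate (phipos _ cp).
  have := state_jensen gstate (phipos _ cp) cpow (convex_powR r1) pow00 pow0.
  apply: le_trans; rewrite ge0_ler_powR ?nnegrE ?phi0 //.
  exact: (state_jensen gstate cp cphi convphi phi00 phi0).
have [ga0 _] := state_cpos gstate apos; have [gb0 _] := state_cpos gstate bpos.
set m := (_ + _) / 2; have m0 : 0 <= m by rewrite divr_ge0 // addr_ge0.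
have phim : phi m <= (phi (complex.Re (g a)) + phi (complex.Re (g b))) / 2.
  exact: convex_midpoint.
set Y := 2^-1 *: _.
have YE : Y = (2^-1)%:C *: (X a + X b) by rewrite /Y fmorphV rmorph_nat.
have Ypos : cpos Y.
  have [j jsa jE] := cposD (Xpos _ apos) (Xpos _ bpos).
  exists ((Num.sqrt 2^-1)%:C *: j); first by rewrite starZr jsa.
  have sqrt2 : Num.sqrt 2^-1 * Num.sqrt 2^-1 = 2^-1 :> R.
    by rewrite -expr2 sqr_sqrtr // invr_ge0.
  by rewrite YE jE -scalerAr -scalerAl scalerA -rmorphM /= sqrt2.
have YB : phi m `^ r <= cnorm Y.
  apply: le_trans (state_le_cnorm gstate Ypos).
  have -> : complex.Re (g Y) = (complex.Re (g (X a)) + complex.Re (g (X b))) / 2.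
    rewrite YE (stateZ g) (stateD g).
    by case: (g (X a)) (g (X b)) => u v [u' v'] /=; ring.
  have pm0 : 0 <= phi m by exact: phi0.
  apply: (@le_trans _ _ (((phi (complex.Re (g a)) + phi (complex.Re (g b))) / 2) `^ r)).
    by rewrite ge0_ler_powR ?nnegrE // (le_trans pm0).
  have := @convex_midpoint _ (fun t : R => t `^ r) _ _ (convex_powR r1) (phi0 _ ga0) (phi0 _ gb0).
  have := XP _ apos; have := XP _ bpos; lra.
have <- : (phi m `^ r) `^ r^-1 = phi m.
  by rewrite -powRrM mulfV ?gt_eqF // powRr1 // phi0.
by rewrite ge0_ler_powR ?nnegrE ?powR_ge0 ?cnorm_ge0 // invr_ge0 ltW.
Qed.

(** A value of [phi] above [B] at the square of the supremum would, by continuity, persist at the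
    square of some element of [S] close to it. *)
Lemma orlicz_sup_sqr_le phi (S : set R) (B : R) : orlicz phi ->
  (forall t, S t -> 0 <= t) -> (forall t, S t -> phi (t ^+ 2) <= B) -> 0 <= B ->
  phi (sup S ^+ 2) <= B.
Proof.
move=> [phi0 cphi _ _ [phi00 _ _]] S0 SB B0.
(* Without a supremum, [sup] defaults to 0, and [phi 0 = 0 <= B]. *)
have [S_sup|/sup_out ->] := pselect (has_sup S); last by rewrite expr0n phi00.
set v := sup S; rewrite leNgt; apply/negP => vB.
have v0 : 0 <= v.
  have [[t St] _] := S_sup.
  by apply: le_trans (S0 _ St) _; apply: ub_le_sup St; exact: S_sup.2.
have vgt0 : 0 < v.
  rewrite lt_neqAle v0 andbT; apply: contraTneq vB => <-.
  by rewrite expr0n phi00 -leNgt.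
have e0 : 0 < (phi (v ^+ 2) - B) / 2 by rewrite divr_gt0 // subr_gt0.
have v2 : `[0, +oo[%classic (v ^+ 2) by rewrite /= in_itv /= andbT sqr_ge0.
have [d d0 dP] := within_continuous_dist cphi v2 e0.
(* [v^2 - t^2] is [v - t] times [v + t <= 2 v], so this gap brings [t^2] within [d] of [v^2]. *)
have [t St vt] := @sup_adherent _ S (d / (2 * v)) (divr_gt0 d0 (mulr_gt0 (ltr0n _ 2) vgt0)) S_sup.
have tv : t <= v by apply: ub_le_sup St; exact: S_sup.2.
have t0 := S0 _ St.
have : `|phi (t ^+ 2) - phi (v ^+ 2)| <= (phi (v ^+ 2) - B) / 2.
  apply: dP; first by rewrite /= in_itv /= andbT sqr_ge0.
  rewrite distrC subr_sqr ger0_norm; last by rewrite mulr_ge0 ?subr_ge0 // addr_ge0.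
  have vt' : v - t < d / (2 * v) by rewrite -/v in vt; lra.
  move: vt'; rewrite ltr_pdivlMr ?mulr_gt0 //; apply: le_lt_trans.
  by rewrite ler_wpM2l ?subr_ge0 //; lra.
have := SB _ St; rewrite ler_norml => ? /andP[]; lra.
Qed.

End Bound.

Theorem theorem2p35 (R : realType) (A : cstarAlgType R) (phi : R -> R)
    (r s : R) (w x y z : A) :
  orlicz phi -> multiplicative_on_nonneg phi -> 1 <= r -> 1 <= s ->
  phi (numerical_radius (2^-1 *: (star x * w + star z * y)) ^+ 2) <=
    cnorm (2^-1 *: (rcfc (fun t : R => t `^ r) (rcfc phi (star w * w)) +
                    rcfc (fun t : R => t `^ r) (rcfc phi (star y * y))))
      `^ r^-1 *
    cnorm (2^-1 *: (rcfc (fun t : R => t `^ s) (rcfc phi (star x * x)) +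
                    rcfc (fun t : R => t `^ s) (rcfc phi (star z * z))))
      `^ s^-1.
Proof.
move=> phiO phiM r1 s1; have [phi0 _ _ monphi _] := phiO.
apply: orlicz_sup_sqr_le => //; last by rewrite mulr_ge0 // powR_ge0.
  by move=> _ [g _ <-]; exact: cabs_ge0.
move=> _ [g gstate <-].
have Gr u := (state_cpos gstate (cpos_starM u)).1.
(* The factor [1/2] inside the radius gets squared; the resulting [1/4] is shared equally between
   [P] and [Q]. *)
pose P := (complex.Re (g (star x * x)) + complex.Re (g (star z * z))) / 2.
pose Q := (complex.Re (g (star w * w)) + complex.Re (g (star y * y))) / 2.
have P0 : 0 <= P by rewrite divr_ge0 // addr_ge0.
have Q0 : 0 <= Q by rewrite divr_ge0 // addr_ge0.
have gPQ : cabs (g (2^-1 *: (star x * w + star z * y))) ^+ 2 <= Q * P.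
  have := state_cauchy_schwarz gstate x w z y.
  set T := star x * w + star z * y; move=> gT.
  have -> : g (2^-1 *: T) = (2^-1)%:C * g T by rewrite linearZ fmorphV rmorph_nat.
  have -> : cabs ((2^-1)%:C * g T) = 2^-1 * cabs (g T).
    by rewrite cabsM Re_norm_real [`|2^-1|]ger0_norm ?invr_ge0.
  by rewrite exprMn /Q /P; lra.
have g0 := sqr_ge0 (cabs (g (2^-1 *: (star x * w + star z * y)))).
apply: (@le_trans _ _ (phi (Q * P))).
  by apply: monphi; rewrite ?in_itv /= ?andbT // mulr_ge0.
rewrite phiM // ler_pM ?phi0 //.
  by apply: state_convex_bound => //; exact: cpos_starM.
by apply: state_convex_bound => //; exact: cpos_starM.
Qed.
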